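(* The class $3\mathrm{LP}_{\bullet}$ of connected $3$-leaf power graphs rooted at a vertex is specified (for all sizes $n\ge 3$, both in the labeled and in the unlabeled setting) by \begin{align*} 3\mathrm{LP}_{\bullet} &= \mathcal{L}_{\bullet}\times(\mathcal{S}_C+\mathcal{S}_X)+\mathcal{K}_{\bullet}\\ \mathcal{S}_C &= \mathrm{Set}_{\ge 2}(\mathcal{L}+\mathcal{S}_X)\\ \mathcal{S}_X &= \mathcal{L}\times \mathrm{Set}_{\ge 1}(\mathcal{L}+\mathcal{S}_X)\\ \mathcal{L} &= \mathcal{Z}+\mathrm{Set}_{\ge 2}(\mathcal{Z})\\ \mathcal{L}_{\bullet} &= \mathcal{Z}_{\bullet}+\mathcal{Z}_{\bullet}\times \mathrm{Set}_{\ge 1}(\mathcal{Z})\\ \mathcal{K}_{\bullet} &= \mathcal{Z}_{\bullet}\times \mathrm{Set}_{\ge 2}(\mathcal{Z}). \end{align*}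
   Context: All graphs are finite and simple. A graph $G=(V,E)$ is a $3$-leaf power graph if there is a tree $T$ whose set of leaves is $V$ such that, for distinct $x,y\in V$, one has $xy\in E$ iff the distance in $T$ between the leaves $x$ and $y$ is at most $3$. The size of a graph is its number of vertices. A graph rooted at a vertex is a graph with one distinguished vertex; in the unlabeled setting such objects are counted up to isomorphism preserving the distinguished vertex, in the labeled setting the vertices are identified with $\{1,\dots,n\}$. Combinatorial classes are in the sense of Flajolet and Sedgewick: $\mathcal{Z}$ is the class with a single object (an atom), of size $1$; $\mathcal{Z}_\bullet$ is also an atom of size $1$ (the root vertex) and is treated exactly as $\mathcal{Z}$ for generating functions; $+$ is disjoint union; $\times$ is Cartesian (labeled: labeled) product; $\mathrm{Set}_{\ge k}(\mathcal{A})$ is the class of sets (in the unlabeled setting: multisets) of at least $k$ objects of $\mathcal{A}$. In the labeled setting, with exponential generating functions, $\mathrm{Set}_{\ge k}(\mathcal A)$ has generating function $\sum_{i\ge k}A(z)^i/i!$; in the unlabeled setting, with ordinary generating functions, the class $\mathrm{Set}(\mathcal A)$ of all multisets has generating function $\exp\big(\sum_{i\ge1}A(z^i)/i\big)$, and $\mathrm{Set}_{\ge k}$ is the restriction to multisets with at least $k$ elements. ''The class is specified by the system'' means: the system determines (uniquely, by recursion on size) auxiliary classes without objects of size $0$, and the class of graphs in question is isomorphic, as a combinatorial class, to the class given by the first equation, i.e. they have the same number of objects of each size $n$, in the labeled as well as in the unlabeled setting. By convention graphs of sizes $1$ and $2$ are excluded from this comparison. *)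

(* Defs.v *)
From mathcomp Require Import all_boot all_fingroup.
From mathcomp Require Import boolp.

Set Implicit Arguments.
Unset Strict Implicit.
Unset Printing Implicit Defensive.

(** ** Graphs: a graph on the finite type [V] is its set of edges. *)

Definition is_graph (V : finType) (G : {set {set V}}) : bool :=
  [forall e in G, #|e| == 2].

(* Irreflexive when [is_graph G], since [set x; x] has one element. *)
Definition adj (V : finType) (G : {set {set V}}) : rel V :=
  fun x y => [set x; y] \in G.

Definition is_connected (V : finType) (G : {set {set V}}) : bool :=
  (0 < #|V|) && [forall x, forall y, connect (adj G) x y].

Definition is_tree (T : finType) (E : {set {set T}}) : Prop :=
  [/\ is_graph E, is_connected E
    & forall c : seq T, 2 < size c -> ~~ ucycleb (adj E) c].

Definition leaves (T : finType) (E : {set {set T}}) : {set T} :=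
  [set x | #|[set y | adj E x y]| == 1].

(* The length of a shortest walk from x to y; its value is #|V| if there is
   none. *)
Definition gdist (V : finType) (G : {set {set V}}) (x y : V) : nat :=
  find (fun k => [exists p : k.-tuple V, path (adj G) x p && (last x p == y)])
       (iota 0 #|V|).

(* The injection [f] identifies V with the set of leaves of the tree. *)
Definition leaf_power (k : nat) (V : finType) (G : {set {set V}}) : Prop :=
  exists (T : finType) (E : {set {set T}}) (f : V -> T),
    [/\ is_tree E, injective f, f @: [set: V] = leaves E
      & forall x y : V, x != y -> adj G x y = (gdist E (f x) (f y) <= k)].

(** ** Combinatorial classes *)

(* [A n] is the finite type of objects of size [n]; for labeled classes, of
   the objects whose atoms are labeled by 0, ..., n-1. *)
Definition cclass := nat -> finType.

Definition cclass_iso (A B : cclass) : Prop := forall n, #|A n| = #|B n|.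

Definition atom : cclass := fun n => 'I_(n == 1).

Definition csum (A B : cclass) : cclass := fun n => (A n + B n)%type.

Record setting := Setting {
  cprod : cclass -> cclass -> cclass;
  csetge : nat -> cclass -> cclass }.

Definition uprod (A B : cclass) : cclass :=
  fun n => {k : 'I_n.+1 & (A k * B (n - k))%type}.

(* A multiset is given by its multiplicities.  Objects of size larger than n,
   and multiplicities larger than n, cannot occur in a multiset of total size n
   as long as [A] has no object of size 0, which is the only case in which the
   construction makes sense. *)
Definition usetge (k : nat) (A : cclass) : cclass :=
  fun n => {m : {ffun {i : 'I_n.+1 & A i} -> 'I_n.+1} |
             (\sum_x m x * tag x == n) && (k <= \sum_x m x)}.

(* The label set is split into S and its complement, and the components are
   relabeled increasingly by S and by ~: S. *)
Definition lprod (A B : cclass) : cclass :=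
  fun n => {S : {set 'I_n} & (A #|S| * B #|~: S|)%type}.

(* A set of labeled objects is a set partition of the labels, with an object
   (relabeled increasingly) on each block.  Blocks are nonempty, so that [A] is
   again meant to have no object of size 0. *)
Definition lsetge (k : nat) (A : cclass) : cclass :=
  fun n => {P : {P : {set {set 'I_n}} | partition P [set: 'I_n] && (k <= #|P|)} &
             {dffun forall B : {B : {set 'I_n} | B \in val P}, A #|val B|}}.

Definition unlabeled : setting := Setting uprod usetge.
Definition labeled : setting := Setting lprod lsetge.

(** ** Rooted connected 3-leaf power graphs *)

Definition rooted_3LP (n : nat) : {set 'I_n * {set {set 'I_n}}} :=
  [set rG | [&& is_graph rG.2, is_connected rG.2 & `[< leaf_power 3 rG.2 >]]].

Definition rooted_iso (n : nat) : rel ('I_n * {set {set 'I_n}}) :=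
  fun rG rH => [exists s : {perm 'I_n},
    (s rG.1 == rH.1) && ([set s @: e | e : {set 'I_n} in rG.2] == rH.2)].

Definition labeled_3LP : cclass := fun n => {rG | rG \in rooted_3LP n}.

Definition unlabeled_3LP : cclass :=
  fun n => {C | C \in equivalence_partition (@rooted_iso n) (rooted_3LP n)}.

(** ** The system *)

(* [Ld] and [Kd] are the classes with a distinguished (root) atom, which counts
   as any other atom. *)
Record classes := Classes {
  LP : cclass; SC : cclass; SX : cclass; L : cclass; Ld : cclass; Kd : cclass }.

Definition system (s : setting) (X : classes) : Prop :=
  let Z := atom in let Zd := atom in
  let Set_ge := csetge s in
  let prod := cprod s in
  cclass_iso (LP X) (csum (prod (Ld X) (csum (SC X) (SX X))) (Kd X)) /\
  cclass_iso (SC X) (Set_ge 2 (csum (L X) (SX X))) /\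
  cclass_iso (SX X) (prod (L X) (Set_ge 1 (csum (L X) (SX X)))) /\
  cclass_iso (L X) (csum Z (Set_ge 2 Z)) /\
  cclass_iso (Ld X) (csum Zd (prod Zd (Set_ge 1 Z))) /\
  cclass_iso (Kd X) (prod Zd (Set_ge 2 Z)).

Definition no_size0 (X : classes) : Prop :=
  [/\ #|SC X 0| = 0, #|SX X 0| = 0, #|L X 0| = 0, #|Ld X 0| = 0
    & #|Kd X 0| = 0].

Definition classes_iso (X Y : classes) : Prop :=
  cclass_iso (LP X) (LP Y) /\ cclass_iso (SC X) (SC Y) /\
  cclass_iso (SX X) (SX Y) /\ cclass_iso (L X) (L Y) /\
  cclass_iso (Ld X) (Ld Y) /\ cclass_iso (Kd X) (Kd Y).

(* The system has a solution, unique up to isomorphism, and its first component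
   is equinumerous with [C] in all sizes at least [n0]. *)
Definition specified_from (n0 : nat) (s : setting) (C : cclass) : Prop :=
  exists X : classes,
    [/\ system s X /\ no_size0 X,
        forall Y : classes, system s Y -> no_size0 Y -> classes_iso X Y
      & forall n, n0 <= n -> #|C n| = #|LP X n|].

(* Main.v *)
From mathcomp Require Import all_boot all_fingroup boolp zify.
Require Import Defs.

Set Implicit Arguments.
Unset Strict Implicit.
Unset Printing Implicit Defensive.

(* A connected 3-leaf power graph is a tree whose nodes are blown up into
   nonempty cliques.  Rooting it at a vertex r makes the vertices a preorder
   (x is below y if the node of x is an ancestor of the node of y) in which
   every two elements below a common one are comparable and r is minimal:
   x and y are adjacent iff they are equivalent or one covers the other.
   Conversely, in a leaf root with at least three leaves, order the leaves by
   the prefix order on the paths from the neighbor of r to their own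
   neighbors.  As soon as there are at least three nodes the preorder is
   recovered from the graph and r, because the equivalence classes are the
   classes of twins and x is below y iff the class of x separates r from y.
   With fewer nodes the graph is complete, which accounts for K.

   Such preorders decompose as the system prescribes: a preorder with a
   minimum is a root block together with a preorder on the remaining vertices,
   and any such preorder is a set of components, each with a minimum.  Counting
   the preorders themselves gives the labeled statement, and counting their
   isomorphism types the unlabeled one. *)

(** * Counting by matching *)

(** Many preorders have the same complete graph, since a complete graph can be cut into a root block
    and one further block in several ways. So only preorders whose part below the root block is not
    total are matched one to one with graphs. That part is exactly an object of S_C + S_X: S_C
    consists of the nonempty forests without a minimum, S_X of the trees with more than one block, L
    of the single blocks, and L + S_X of all trees. The factor with the marked atom is the root
    block with the root distinguished in it.

    In the unlabeled setting isomorphisms are not canonical and no explicit bijection is at hand.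
    Counting therefore goes through relations that are total and single-valued in both directions,
    between fixed representatives of the isomorphism types. A multiset of tree types is turned back
    into a forest by taking disjoint copies. *)

Lemma leq_card_rel (X Y : finType) (A : {set X}) (B : {set Y})
    (M : X -> Y -> Prop) :
  (forall x, x \in A -> exists2 y, y \in B & M x y) ->
  (forall x x' y, x \in A -> x' \in A -> y \in B ->
     M x y -> M x' y -> x = x') ->
  #|A| <= #|B|.
Proof.
move=> tot inj; pose f x := [pick y in B | `[< M x y >]].
have fP x : x \in A -> exists2 y, y \in B & f x = Some y /\ M x y.
  move=> xA; rewrite /f; case: pickP => [y /andP[yB /asboolP Mxy]|no].
    by exists y.
  have [y yB Mxy] := tot x xA; move: (no y) => /=.
  by rewrite yB; move/negbT/negP; case; apply/asboolP.
have finj : {in A &, injective f}.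
  move=> x x' xA x'A; have [y yB [-> Mxy]] := fP x xA.
  have [y' yB' [-> Mxy']] := fP x' x'A => -[yy']; subst y'.
  exact: inj Mxy Mxy'.
have SI : injective (@Some Y) by move=> ? ? [].
rewrite -(card_in_imset finj) -(card_imset _ SI).
apply/subset_leq_card/subsetP => _ /imsetP[x xA ->].
by have [y yB [-> _]] := fP x xA; apply: imset_f.
Qed.

(** Isomorphism types are matched with other data through unspecified isomorphisms; this compares
    their numbers without building a bijection. *)
Lemma card_rel (X Y : finType) (A : {set X}) (B : {set Y})
    (M : X -> Y -> Prop) :
  (forall x, x \in A -> exists2 y, y \in B & M x y) ->
  (forall y, y \in B -> exists2 x, x \in A & M x y) ->
  (forall x x' y, x \in A -> x' \in A -> y \in B ->
     M x y -> M x' y -> x = x') ->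
  (forall x y y', x \in A -> y \in B -> y' \in B ->
     M x y -> M x y' -> y = y') ->
  #|A| = #|B|.
Proof.
move=> totA totB injA injB; apply/eqP; rewrite eqn_leq.
rewrite (leq_card_rel totA injA) (@leq_card_rel _ _ B A (fun y x => M x y)) //.
by move=> y y' x yB y'B xA; apply: injB xA yB y'B.
Qed.

(** The i-th element of each fiber of [g] goes to the i-th element of the equinumerous fiber of
    [h]. *)
Lemma fiber_bijection (X Y T : finType) (g : X -> T) (h : Y -> T) :
  (forall t, #|[set x | g x == t]| = #|[set y | h y == t]|) ->
  exists2 f : X -> Y, bijective f & forall x, h (f x) = g x.
Proof.
(* [nth] needs a default in [Y]; when [Y] is empty, so are the fibers of [g], and hence [X]. *)
move=> E; have [y0 _|Y0] := pickP (predT : pred Y); last first.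
  have Y0' (y : Y) : False by have := Y0 y.
  have X0 (x : X) : False.
    have h0 : [set y | h y == g x] = set0 by apply/setP => y; case: (Y0' y).
    have /eqP := E (g x); rewrite h0 cards0 cards_eq0 => /eqP/setP/(_ x).
    by rewrite !inE eqxx.
  exists (fun x => False_rect Y (X0 x)) => [|x]; last by case: (X0 x).
  by exists (fun y => False_rect X (Y0' y)) => [x|y]; [case: (X0 x)|case: (Y0' y)].
pose A t := enum [set x | g x == t]; pose B t := enum [set y | h y == t].
pose f x := nth y0 (B (g x)) (index x (A (g x))).
have szAB t : size (A t) = size (B t) by rewrite /A /B -!cardE E.
have idx x : index x (A (g x)) < size (B (g x)).
  by rewrite -szAB index_mem mem_enum inE.
have hf x : h (f x) = g x.
  have : f x \in B (g x) by apply: mem_nth.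
  by rewrite mem_enum inE => /eqP.
exists f => //; apply: inj_card_bij.
  move=> x x' eqf; have eqg : g x = g x' by rewrite -hf eqf hf.
  move: eqf; rewrite /f eqg => /eqP; rewrite nth_uniq ?enum_uniq //.
    move=> /eqP /(congr1 (nth x (A (g x')))).
    by rewrite !nth_index ?mem_enum ?inE ?eqg.
  by rewrite -eqg.
have cardE (Z : finType) (k : Z -> T) : #|Z| = \sum_t #|[set z | k z == t]|.
  rewrite -sum1_card (partition_big k predT) //=; apply: eq_bigr => t _.
  by rewrite -sum1dep_card.
by rewrite (cardE X g) (cardE Y h) (eq_bigr _ (fun t _ => E t)).
Qed.

(** Label each point of [V] by its preimage, or by [None]: the labelings coming from [f] and from
    [f'] have fibers of the same sizes. *)
Lemma extend_injection (W V : finType) (f f' : W -> V) :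
  injective f -> injective f' ->
  exists2 g : V -> V, injective g & forall w, g (f w) = f' w.
Proof.
move=> fI f'I.
pose lab (k : W -> V) v := [pick w | k w == v].
have labP (k : W -> V) : injective k -> forall v w, (lab k v == Some w) = (k w == v).
  move=> kI v w; rewrite /lab; case: pickP => [w' /eqP <-|/(_ w) //].
  by apply/eqP/eqP => [[->]//|/kI ->].
have cSome (k : W -> V) (kI : injective k) w : #|[set v | lab k v == Some w]| = 1.
  rewrite -(cards1 (k w)); apply: eq_card => v.
  by rewrite !inE labP // eq_sym.
have cNone (k : W -> V) (kI : injective k) :
    #|[set v | lab k v == None]| = #|V| - #|W|.
  rewrite (_ : [set v | _] = ~: (k @: setT)).
    by rewrite cardsCs setCK card_imset // cardsT.
  apply/setP => v; rewrite !inE /lab; case: pickP => [w /eqP <-|no].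
    by rewrite imset_f.
  by rewrite eqxx; apply/esym/imsetP => -[w _ vw]; have := no w; rewrite vw eqxx.
have [|g gB gE] := @fiber_bijection _ _ _ (lab f) (lab f').
  by case=> [w|]; rewrite ?cSome ?cNone.
exists g => [|w]; first exact: bij_inj.
by apply/eqP; rewrite eq_sym -(labP _ f'I) gE labP.
Qed.

(** * Forest preorders *)

(* Relations are sets of pairs contained in B x B, so that a forest on V can be
   cut into forests on the blocks of a partition without changing types. *)
Definition forest (V : finType) (B : {set V}) (s : {set V * V}) : bool :=
  [&& s \subset setX B B, [forall x in B, (x, x) \in s],
      [forall x in B, forall y in B, forall z in B,
         ((x, y) \in s) ==> ((y, z) \in s) ==> ((x, z) \in s)]
    & [forall x in B, forall y in B, forall z in B,
         ((x, z) \in s) ==> ((y, z) \in s) ==>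
         ((x, y) \in s) || ((y, x) \in s)]].

Definition has_min (V : finType) (B : {set V}) (s : {set V * V}) : bool :=
  [exists x in B, forall y in B, (x, y) \in s].

Definition total_on (V : finType) (B : {set V}) (s : {set V * V}) : bool :=
  [forall x in B, forall y in B, (x, y) \in s].

(* g is applied to "there is a minimum", "all elements are equivalent" and "B is
   empty". *)
Definition kind (g : bool -> bool -> bool -> bool) (V : finType) (B : {set V})
    (s : {set V * V}) : bool :=
  forest B s && g (has_min B s) (total_on B s) (B == set0).

(** The counterparts, in order, of L + S_X, S_X, Set_{>=1}(L + S_X), S_C and S_C + S_X. The empty
    relation on the empty set is total, so [spread_kind] leaves it out. *)
Definition tree_kind (m t e : bool) : bool := m.
Definition thick_tree_kind (m t e : bool) : bool := m && ~~ t.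
Definition forest1_kind (m t e : bool) : bool := ~~ e.
Definition forest2_kind (m t e : bool) : bool := ~~ e && ~~ m.
Definition spread_kind (m t e : bool) : bool := ~~ t.

Lemma forestP (V : finType) (B : {set V}) (s : {set V * V}) :
  reflect [/\ forall x y, (x, y) \in s -> x \in B /\ y \in B,
              forall x, x \in B -> (x, x) \in s,
              forall x y z, (x, y) \in s -> (y, z) \in s -> (x, z) \in s
            & forall x y z, (x, z) \in s -> (y, z) \in s ->
                (x, y) \in s \/ (y, x) \in s]
          (forest B s).
Proof.
apply: (iffP and4P) => [[/subsetP sB rfl tr lin]|[sB rfl tr lin]].
  have sB2 x y : (x, y) \in s -> x \in B /\ y \in B.
    by move/sB; rewrite inE => /andP[].
  split=> // [x xB|x y z xy yz|x y z xz yz].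
  - by move/'forall_implyP: rfl; apply.
  - have [[xB yB] [_ zB]] := (sB2 _ _ xy, sB2 _ _ yz).
    move/'forall_implyP/(_ x xB)/'forall_implyP/(_ y yB)/'forall_implyP: tr.
    by move/(_ z zB); rewrite xy yz.
  have [[xB zB] [yB _]] := (sB2 _ _ xz, sB2 _ _ yz).
  move/'forall_implyP/(_ x xB)/'forall_implyP/(_ y yB)/'forall_implyP: lin.
  by move/(_ z zB); rewrite xz yz => /orP.
split.
- by apply/subsetP => -[x y] /sB[xB yB]; rewrite inE xB.
- by apply/'forall_implyP.
- apply/'forall_implyP => x _; apply/'forall_implyP => y _.
  apply/'forall_implyP => z _; apply/implyP => xy; apply/implyP; exact: tr xy.
apply/'forall_implyP => x _; apply/'forall_implyP => y _.
apply/'forall_implyP => z _; apply/implyP => xz; apply/implyP => yz.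
by apply/orP; exact: lin yz.
Qed.

(** * Transport along injections and restriction to blocks *)

Definition push (W V : finType) (f : W -> V) (t : {set W * W}) : {set V * V} :=
  [set (f p.1, f p.2) | p in t].

Definition restrict (V : finType) (B : {set V}) (s : {set V * V}) : {set V * V} :=
  s :&: setX B B.

Lemma in_restrict (V : finType) (B : {set V}) (s : {set V * V}) x y :
  ((x, y) \in restrict B s) = [&& (x, y) \in s, x \in B & y \in B].
Proof. by rewrite !inE. Qed.

Section Push.
Variables (W V : finType) (f : W -> V).
Hypothesis fI : injective f.

Lemma in_push t a b : ((f a, f b) \in push f t) = ((a, b) \in t).
Proof.
apply/imsetP/idP => [[[a' b'] ab' /= [/fI-> /fI->]] //|ab].
by exists (a, b).
Qed.

Lemma push_in t x y : (x, y) \in push f t ->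
  exists a b, [/\ x = f a, y = f b & (a, b) \in t].
Proof. by case/imsetP => -[a b] /= ab [-> ->]; exists a, b. Qed.

Lemma forall_imset (A : {set W}) (P : pred V) :
  [forall x in f @: A, P x] = [forall a in A, P (f a)].
Proof.
apply/'forall_implyP/'forall_implyP => [H a aA|H x /imsetP[a aA ->]].
  by apply: H; apply: imset_f.
exact: H.
Qed.

Lemma eq_forall_in (T : finType) (A : {set T}) (P Q : pred T) :
  P =1 Q -> [forall x in A, P x] = [forall x in A, Q x].
Proof. by move=> PQ; apply: eq_forallb => x; rewrite PQ. Qed.

Lemma push_sub (A : {set W}) t :
  (push f t \subset setX (f @: A) (f @: A)) = (t \subset setX A A).
Proof.
apply/subsetP/subsetP => [H [a b] ab|H _ /imsetP[[a b] ab ->]].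
  have := H (f a, f b); rewrite in_push => /(_ ab).
  by rewrite !inE /= !mem_imset.
by have := H _ ab; rewrite !inE /= !mem_imset.
Qed.

Lemma has_min_push (A : {set W}) t :
  has_min (f @: A) (push f t) = has_min A t.
Proof.
apply/negb_inj; rewrite !negb_exists.
rewrite (eq_forallb (P2 := fun x => (x \in f @: A) ==>
  ~~ [forall y in f @: A, (x, y) \in push f t])); last first.
  by move=> x; rewrite negb_and implybE.
rewrite forall_imset; apply: eq_forallb => a; rewrite negb_and implybE.
by congr (_ || ~~ _); rewrite forall_imset; apply: eq_forall_in => b; rewrite in_push.
Qed.

Lemma total_on_push (A : {set W}) t :
  total_on (f @: A) (push f t) = total_on A t.
Proof.
rewrite /total_on forall_imset; apply: eq_forall_in => a.
by rewrite forall_imset; apply: eq_forall_in => b; rewrite in_push.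
Qed.

Lemma forest_push (A : {set W}) t : forest (f @: A) (push f t) = forest A t.
Proof.
rewrite /forest push_sub; congr [&& _, _, _ & _].
- by rewrite forall_imset; apply: eq_forall_in => a; rewrite in_push.
- rewrite forall_imset; apply: eq_forall_in => a.
  rewrite forall_imset; apply: eq_forall_in => b.
  by rewrite forall_imset; apply: eq_forall_in => c; rewrite !in_push.
rewrite forall_imset; apply: eq_forall_in => a.
rewrite forall_imset; apply: eq_forall_in => b.
by rewrite forall_imset; apply: eq_forall_in => c; rewrite !in_push.
Qed.

Lemma kind_push g (A : {set W}) t : kind g (f @: A) (push f t) = kind g A t.
Proof.
rewrite /kind forest_push has_min_push total_on_push; congr (_ && g _ _ _).
by rewrite -!cards_eq0 card_imset.
Qed.

Lemma push_inj : injective (push f).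
Proof. by move=> t u e; apply/setP => -[a b]; rewrite -!in_push e. Qed.

Lemma push_pull (s : {set V * V}) : s \subset setX (f @: setT) (f @: setT) ->
  push f [set p | (f p.1, f p.2) \in s] = s.
Proof.
move=> /subsetP sB; apply/setP => -[x y]; apply/idP/idP.
  by case/push_in => a [b [-> -> ]]; rewrite inE.
move=> xy; have := sB _ xy; rewrite inE => /andP[/imsetP[a _ /= ea] /imsetP[b _ /= eb]].
by move: xy; rewrite ea eb in_push inE.
Qed.

Lemma restrict_push (A : {set W}) t : restrict (f @: A) (push f t) = push f (restrict A t).
Proof.
apply/setP => -[x y]; rewrite in_restrict; apply/and3P/idP.
  case=> /push_in[a [b [-> -> ab]]].
  by rewrite !mem_imset // in_push in_restrict ab => -> ->.
case/push_in => a [b [-> ->]]; rewrite in_restrict => /and3P[ab aA bA].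
by rewrite in_push ab !mem_imset.
Qed.

End Push.

Lemma push_comp (U W V : finType) (f : W -> V) (g : U -> W) (t : {set U * U}) :
  push f (push g t) = push (f \o g) t.
Proof. by rewrite /push -imset_comp. Qed.

Lemma eq_push (W V : finType) (f g : W -> V) (t : {set W * W}) : f =1 g -> push f t = push g t.
Proof. by move=> fg; apply: eq_imset => p; rewrite !fg. Qed.

Lemma push_id (V : finType) (s : {set V * V}) : push id s = s.
Proof. by rewrite /push -[RHS]imset_id; apply: eq_imset => -[]. Qed.

Lemma restrictT (V : finType) (s : {set V * V}) : restrict setT s = s.
Proof. by apply/setP => -[x y]; rewrite in_restrict !inE !andbT. Qed.

Lemma forest_sub (V : finType) (B : {set V}) (s : {set V * V}) : forest B s -> s \subset setX B B.
Proof. by case/and4P. Qed.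

Lemma forest_restrict (V : finType) (B C : {set V}) (s : {set V * V}) :
  forest B s -> C \subset B -> forest C (restrict C s).
Proof.
move=> /forestP[sB rfl tr lin] /subsetP CB; apply/forestP; split.
- by move=> x y; rewrite in_restrict => /and3P[].
- by move=> x xC; rewrite in_restrict xC rfl ?CB.
- move=> x y z; rewrite !in_restrict => /and3P[xy -> _] /and3P[yz _ ->].
  by rewrite (tr _ _ _ xy yz).
move=> x y z; rewrite !in_restrict => /and3P[xz -> _] /and3P[yz -> _].
by rewrite !andbT; apply: lin yz.
Qed.

Lemma has_minP (V : finType) (B : {set V}) (s : {set V * V}) :
  reflect (exists2 x, x \in B & forall y, y \in B -> (x, y) \in s) (has_min B s).
Proof.
apply: (iffP existsP) => [[x /andP[xB /'forall_implyP H]]|[x xB H]].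
  by exists x.
by exists x; rewrite xB; apply/'forall_implyP.
Qed.

Lemma total_onP (V : finType) (B : {set V}) (s : {set V * V}) :
  reflect (forall x y, x \in B -> y \in B -> (x, y) \in s) (total_on B s).
Proof.
apply: (iffP 'forall_implyP) => [H x y xB yB|H x xB].
  by move/'forall_implyP: (H x xB); apply.
by apply/'forall_implyP => y yB; apply: H.
Qed.

(** * Components of a forest *)

Section Components.
Variables (V : finType) (B : {set V}) (s : {set V * V}).
Hypothesis sF : forest B s.

(** Having a common lower bound is already transitive in a forest, because two lower bounds of one
    element are comparable; no closure under walks has to be taken. *)
Definition component (s : {set V * V}) (x : V) : {set V} :=
  [set y | [exists z, ((z, x) \in s) && ((z, y) \in s)]].
Definition components (s : {set V * V}) (B : {set V}) : {set {set V}} := component s @: B.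

Let sB x y : (x, y) \in s -> x \in B /\ y \in B. Proof. by case/forestP: sF => H _ _ _; apply: H. Qed.
Let rfl x : x \in B -> (x, x) \in s. Proof. by case/forestP: sF => _ H _ _; apply: H. Qed.
Let tr x y z : (x, y) \in s -> (y, z) \in s -> (x, z) \in s.
Proof. by case/forestP: sF => _ _ H _; apply: H. Qed.
Let lin x y z : (x, z) \in s -> (y, z) \in s -> (x, y) \in s \/ (y, x) \in s.
Proof. by case/forestP: sF => _ _ _ H; apply: H. Qed.

Lemma componentP x y :
  reflect (exists2 z, (z, x) \in s & (z, y) \in s) (y \in component s x).
Proof.
rewrite inE; apply: (iffP existsP) => [[z /andP[]]|[z zx zy]]; first by exists z.
by exists z; rewrite zx zy.
Qed.

Lemma component_refl x : x \in B -> x \in component s x.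
Proof. by move=> xB; apply/componentP; exists x; exact: rfl. Qed.

Lemma component_sub x : component s x \subset B.
Proof. by apply/subsetP => y /componentP[z _ /sB[]]. Qed.

Lemma component_sym x y : (y \in component s x) = (x \in component s y).
Proof. by apply/componentP/componentP => -[z zx zy]; exists z. Qed.

Lemma component_trans x y z : y \in component s x -> z \in component s y -> z \in component s x.
Proof.
move=> /componentP[u ux uy] /componentP[v vy vz]; apply/componentP.
case: (lin uy vy) => [uv|vu]; first by exists u; last exact: tr vz.
by exists v; first exact: tr ux.
Qed.

Lemma component_eq x y : y \in component s x -> component s y = component s x.
Proof.
move=> xy; apply/setP => z; apply/idP/idP; first exact: component_trans.
by apply: component_trans; rewrite component_sym.
Qed.

Lemma components_eq C x : C \in components s B -> x \in C -> C = component s x.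
Proof. by case/imsetP => y yB -> /component_eq. Qed.

Lemma le_component x y : (x, y) \in s -> component s x = component s y.
Proof. by move=> xy; apply: component_eq; apply/componentP; exists x => //; apply: rfl; case: (sB xy). Qed.

Lemma components_partition : partition (components s B) B.
Proof.
apply/and3P; split.
- rewrite eqEsubset; apply/andP; split.
    by apply/bigcupsP => C /imsetP[x _ ->]; apply: component_sub.
  apply/subsetP => x xB; apply/bigcupP; exists (component s x); last exact: component_refl.
  exact: imset_f.
- apply/trivIsetP => C D CP DP; apply: contraNT => /pred0Pn[x /andP[/= xC xD]].
  by rewrite (components_eq CP xC) (components_eq DP xD).
apply/imsetP => -[x xB] /setP/(_ x); rewrite component_refl //.
by rewrite inE.
Qed.

(** Take [y] in the component with the fewest elements below it. Any [z] shares a lower bound [u]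
    with [y]; by minimality [u] has as many elements below it as [y], so [y] is below [u] and thus
    below [z]. *)
Lemma component_has_min x : x \in B -> has_min (component s x) s.
Proof.
move=> xB; pose dn y := #|[set z | (z, y) \in s]|.
case: (@arg_minnP _ x (mem (component s x)) dn); first exact: component_refl.
move=> y xy ymin; apply/has_minP; exists y => // z xz.
have /componentP[u uy uz] : z \in component s y by rewrite (component_eq xy).
apply: tr uz; have ux : u \in component s x.
  rewrite -(component_eq xy) -(le_component uy) component_refl //; by case: (sB uy).
have sub : [set z | (z, u) \in s] \subset [set z | (z, y) \in s].
  by apply/subsetP => v; rewrite !inE => vu; apply: tr uy.
have /eqP e : [set z | (z, u) \in s] == [set z | (z, y) \in s].
  by rewrite eqEcard sub; apply: ymin.
have : y \in [set z | (z, y) \in s] by rewrite inE rfl //; case: (sB uy).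
by rewrite -e inE.
Qed.

Lemma components_tree C : C \in components s B -> kind tree_kind C (restrict C s).
Proof.
case/imsetP => x xB ->; rewrite /kind (forest_restrict sF (component_sub x)) /tree_kind /=.
case/has_minP: (component_has_min xB) => y yC H; apply/has_minP; exists y => // z zC.
by rewrite in_restrict H ?yC.
Qed.

Lemma card_components_gt0 : (0 < #|components s B|) = (B != set0).
Proof.
apply/card_gt0P/set0Pn => [[_ /imsetP[x xB _]]|[x xB]]; first by exists x.
by exists (component s x); apply: imset_f.
Qed.

(** A minimum puts everything into one component, and a single component has a minimum. This
    translates the bound in Set_{>=2}. *)
Lemma card_components_gt1 : (1 < #|components s B|) = (B != set0) && ~~ has_min B s.
Proof.
apply/idP/andP => [c2|[/set0Pn[x xB] nm]].
  rewrite -card_components_gt0 (ltn_trans _ c2) //; split=> //.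
  apply/negP => /has_minP[x xB xm]; move: c2.
  rewrite (_ : components s B = [set component s x]) ?cards1 //.
  apply/setP => C; rewrite inE; apply/imsetP/eqP => [[y yB ->]|->]; last by exists x.
  by apply/esym/le_component/xm.
rewrite ltnNge; apply/negP => c1; case/negP: nm.
case/has_minP: (component_has_min xB) => y yC ym; apply/has_minP.
exists y => [|z zB]; first exact: (subsetP (component_sub x)).
apply: ym; rewrite (card_le1_eqP c1 (component s z) (component s x)) ?imset_f //.
exact: component_refl.
Qed.

Lemma bigcup_components : s = \bigcup_(C in components s B) restrict C s.
Proof.
apply/setP => -[x y]; apply/idP/bigcupP => [xy|[C _]]; last by rewrite in_restrict => /and3P[].
have [xB yB] := sB xy.
exists (component s x); first exact: imset_f.
by rewrite in_restrict xy component_refl //= (le_component xy) component_refl.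
Qed.

End Components.

(** * Gluing trees along the blocks of a partition *)

Section Join.
Variables (V : finType) (B : {set V}) (P : {set {set V}}).
Variable (S : {set V} -> {set V * V}).
Hypothesis PB : partition P B.
Hypothesis StrT : forall C, C \in P -> kind tree_kind C (S C).

Definition join (P : {set {set V}}) S : {set V * V} := \bigcup_(C in P) S C.

Let foS C : C \in P -> forest C (S C). Proof. by move/StrT/andP=> []. Qed.

Lemma block_uniq C D x : C \in P -> D \in P -> x \in C -> x \in D -> C = D.
Proof.
case/and3P: PB => _ /trivIsetP tP _ CP DP xC xD; apply/eqP; apply/negP => /negP CD.
by have /pred0P/(_ x) := tP _ _ CP DP CD; rewrite /= xC xD.
Qed.

Lemma join_in C x y : C \in P -> x \in C -> ((x, y) \in join P S) = ((x, y) \in S C).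
Proof.
move=> CP xC; apply/bigcupP/idP => [[D DP xy]|]; last by exists C.
suff -> : C = D by [].
by case/forestP: (foS DP) => H _ _ _; case: (H _ _ xy) => xD _; apply: block_uniq xD.
Qed.

Lemma join_in_r C x y : C \in P -> y \in C -> ((x, y) \in join P S) = ((x, y) \in S C).
Proof.
move=> CP xC; apply/bigcupP/idP => [[D DP xy]|]; last by exists C.
suff -> : C = D by [].
by case/forestP: (foS DP) => H _ _ _; case: (H _ _ xy) => _ xD; apply: block_uniq xD.
Qed.

Lemma join_sub C x y : C \in P -> (x, y) \in S C -> x \in C /\ y \in C.
Proof. by move=> CP xy; case/forestP: (foS CP) => H _ _ _; apply: H. Qed.

Lemma in_block x : x \in B -> exists2 C, C \in P & x \in C.
Proof. by rewrite -(cover_partition PB) => /bigcupP. Qed.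

Lemma join_forest : forest B (join P S).
Proof.
have CB C : C \in P -> C \subset B.
  by rewrite -(cover_partition PB) => CP; apply: bigcup_sup.
apply/forestP; split.
- move=> x y /bigcupP[C CP /(join_sub CP)[xC yC]].
  by split; apply: (subsetP (CB C CP)).
- move=> x /in_block[C CP xC]; rewrite (join_in _ CP xC).
  by case/forestP: (foS CP) => _ H _ _; apply: H.
- move=> x y z /bigcupP[C CP xy]; have [xC yC] := join_sub CP xy.
  rewrite (join_in _ CP yC) (join_in _ CP xC).
  by case/forestP: (foS CP) => _ _ H _; apply: H xy.
move=> x y z /bigcupP[C CP xz]; have [xC zC] := join_sub CP xz.
rewrite (join_in_r _ CP zC) => yz; have [yC _] := join_sub CP yz.
rewrite (join_in _ CP yC) (join_in _ CP xC).
by case/forestP: (foS CP) => _ _ _ H; apply: H yz.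
Qed.

(** No pair leaves a block, and the minimum of a block is a common lower bound of all its elements,
    so that gluing neither merges nor splits blocks. *)
Lemma join_component C x : C \in P -> x \in C -> component (join P S) x = C.
Proof.
move=> CP xC; apply/setP => y; apply/componentP/idP.
  case=> z; rewrite (join_in_r _ CP xC) => /(join_sub CP)[zC _].
  by rewrite (join_in _ CP zC) => /(join_sub CP)[].
have /andP[_ /has_minP[z zC zm]] := StrT CP.
by move=> yC; exists z; rewrite (join_in _ CP zC) zm.
Qed.

Lemma join_components : components (join P S) B = P.
Proof.
apply/setP => C; apply/imsetP/idP => [[x /in_block[D DP xD] ->]|CP].
  by rewrite (join_component DP xD).
have /andP[_ /has_minP[x xC _]] := StrT CP.
exists x; last by rewrite (join_component CP xC).
by rewrite -(cover_partition PB); apply/bigcupP; exists C.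
Qed.

Lemma restrict_join C : C \in P -> restrict C (join P S) = S C.
Proof.
move=> CP; apply/setP => -[x y]; rewrite in_restrict; apply/and3P/idP => [[+ xC _]|xy].
  by rewrite (join_in _ CP xC).
by have [xC yC] := join_sub CP xy; rewrite (join_in _ CP xC).
Qed.

End Join.

(** * Splitting off the root block *)

Section Hang.
Variable V : finType.
Implicit Types (A : {set V}) (s : {set V * V}).

(* The root block is A, and below it hangs s, carried by the complement. *)
Definition hang A s : {set V * V} := setX A setT :|: s.

Definition root_block s : {set V} := [set x | [forall y, (x, y) \in s]].

Lemma in_hang A s x y : ((x, y) \in hang A s) = (x \in A) || ((x, y) \in s).
Proof. by rewrite !inE /= andbT. Qed.

Lemma hang_forest A s : forest (~: A) s -> forest setT (hang A s).
Proof.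
case/forestP => sB rfl tr lin; apply/forestP; split=> //.
- by move=> x _; rewrite in_hang -implyNb; apply/implyP => xA; apply: rfl; rewrite inE.
- move=> x y z; rewrite !in_hang; case: (x \in A) => //= xy; case/orP => [yA|].
    by have [_] := sB _ _ xy; rewrite inE yA.
  exact: tr.
move=> x y z; rewrite !in_hang; case: (x \in A) => /=; first by left.
case: (y \in A) => /=; [by right | exact: lin].
Qed.

Lemma root_block_hang A s : A != set0 -> forest (~: A) s -> root_block (hang A s) = A.
Proof.
case/set0Pn => a aA /forestP[sB _ _ _]; apply/setP => x; rewrite inE.
apply/forallP/idP => [/(_ a)|xA y]; last by rewrite in_hang xA.
rewrite in_hang; case/orP => // /sB[_]; by rewrite inE aA.
Qed.

Lemma hang_min A s : A != set0 -> has_min setT (hang A s).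
Proof.
by case/set0Pn => a aA; apply/has_minP; exists a => // y _; rewrite in_hang aA.
Qed.

Lemma restrict_hang A s : forest (~: A) s -> restrict (~: A) (hang A s) = s.
Proof.
move=> sF; apply/setP => -[x y]; rewrite in_restrict in_hang !inE.
apply/and3P/idP => [[/orP[->|] //]|xy].
by case/forestP: sF => H _ _ _; have := H _ _ xy; rewrite !inE xy orbT => -[].
Qed.

Lemma root_block_neq0 s : (root_block s != set0) = has_min setT s.
Proof.
apply/set0Pn/has_minP => [[x]|[x _ xm]].
  by rewrite inE => /forallP xm; exists x.
by exists x; rewrite inE; apply/forallP => y; apply: xm.
Qed.

Lemma root_block_in s x : x \in root_block s -> forall y, (x, y) \in s.
Proof. by rewrite inE => /forallP. Qed.

Lemma root_block_down s x y : forest setT s ->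
  (x, y) \in s -> y \in root_block s -> x \in root_block s.
Proof.
case/forestP=> _ _ tr _ xy; rewrite !inE => /forallP yr.
by apply/forallP => z; apply: tr (yr z).
Qed.

Lemma hang_root s : forest setT s -> hang (root_block s) (restrict (~: root_block s) s) = s.
Proof.
move=> sF; apply/setP => -[x y]; rewrite in_hang in_restrict; apply/orP/idP.
  by case=> [/root_block_in//|/and3P[]].
move=> xy; case: (boolP (x \in root_block s)) => [|xr]; [by left|right].
rewrite xy !in_setC xr; apply: contra xr; exact: root_block_down xy.
Qed.

Lemma total_hang A s : forest (~: A) s -> A != set0 ->
  total_on setT (hang A s) = (~: A == set0).
Proof.
move=> sF A0; apply/total_onP/eqP => [H|H x y _ _].
  case/set0Pn: A0 => a aA; apply/setP => x; rewrite !inE.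
  have := H x a; rewrite in_hang !inE => /(_ isT isT)/orP[->//|].
  by case/forestP: sF => /(_ x a) sB _ _ _ /sB[_]; rewrite inE aA.
by rewrite in_hang; have /setP/(_ x) := H; rewrite !inE => /negbFE ->.
Qed.

End Hang.

Lemma root_block_push (W V : finType) (f : W -> V) (s : {set W * W}) :
  injective f -> f @: setT = setT -> root_block (push f s) = f @: root_block s.
Proof.
move=> fI fT; have fs x : exists a, x = f a.
  by have /imsetP[a _ ->] : x \in f @: setT; [rewrite fT inE | exists a].
apply/setP => x; have [a ->] := fs x; rewrite mem_imset // !inE.
apply/forallP/forallP => [H b|H y]; first by rewrite -(in_push fI).
by have [b ->] := fs y; rewrite in_push.
Qed.

Lemma push_hang (V : finType) (f : V -> V) (A : {set V}) (s : {set V * V}) : injective f ->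
  push f (hang A s) = hang (f @: A) (push f s).
Proof.
move=> fI; have fs x : exists a, x = f a by exists (invF fI x); rewrite f_invF.
apply/setP => -[x y]; have [a ->] := fs x; have [b ->] := fs y.
by rewrite in_hang !in_push // in_hang mem_imset.
Qed.

(** * The graph of a tree preorder *)

Lemma eq_pair_set (V : finType) (x y u v : V) :
  [set x; y] = [set u; v] -> (x = u /\ y = v) \/ (x = v /\ y = u).
Proof.
move=> /setP e; have := e x; have := e y; have := e u; have := e v.
rewrite !inE !eqxx !orbT /=.
move=> /orP[]/eqP-> /orP[]/eqP-> /esym/orP[]/eqP E1 /esym/orP[]/eqP E2; subst; auto.
Qed.

Definition edges_of (V : finType) (e : rel V) : {set {set V}} :=
  [set [set p.1; p.2] | p in [pred p : V * V | e p.1 p.2]].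

Lemma adj_edges_of (V : finType) (e : rel V) : symmetric e ->
  adj (edges_of e) =2 e.
Proof.
move=> eS x y; apply/imsetP/idP => [[[u v] /= uv /eq_pair_set[] [-> ->]] //|xy].
  by rewrite eS.
by exists (x, y).
Qed.

Lemma edges_of_graph (V : finType) (e : rel V) : irreflexive e ->
  is_graph (edges_of e).
Proof.
move=> eI; apply/'forall_implyP => _ /imsetP[[x y] /= xy ->].
by move: xy; rewrite cards2 inE /=; case: (x =P y) => // ->; rewrite eI.
Qed.

Lemma adj_sym (V : finType) (G : {set {set V}}) : symmetric (adj G).
Proof. by move=> x y; rewrite /adj setUC. Qed.

Lemma adj_irr (V : finType) (G : {set {set V}}) x : is_graph G -> adj G x x = false.
Proof.
move=> /'forall_implyP gG; apply/negP => /gG; by rewrite setUid cards1.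
Qed.

Lemma graph_ext (V : finType) (G H : {set {set V}}) :
  is_graph G -> is_graph H -> adj G =2 adj H -> G = H.
Proof.
move=> /'forall_implyP gG /'forall_implyP gH e; apply/setP => a.
apply/idP/idP => aX.
  by have /cards2P[x [y [_ Ea]]] := gG _ aX; have := e x y; rewrite /adj -Ea aX.
by have /cards2P[x [y [_ Ea]]] := gH _ aX; have := e x y; rewrite /adj -Ea aX.
Qed.

(* Also true when x and y are equivalent. *)
Definition cover_le (V : finType) (s : {set V * V}) (x y : V) : bool :=
  ((x, y) \in s) && [forall z, ((x, z) \in s) ==> ((z, y) \in s) ==>
     (((z, x) \in s) || ((y, z) \in s))].

Definition cover_adj (V : finType) (s : {set V * V}) : rel V :=
  fun x y => (x != y) && (cover_le s x y || cover_le s y x).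

Definition graph_of (V : finType) (s : {set V * V}) : {set {set V}} :=
  edges_of (cover_adj s).

Section Graph.
Variables (V : finType) (s : {set V * V}) (r : V).
Hypothesis sF : forest setT s.
Hypothesis rmin : forall y, (r, y) \in s.

Notation "x <<= y" := ((x, y) \in s) (at level 70).
Notation equ x y := ((x <<= y) && (y <<= x)).

Let rfl x : x <<= x. Proof. by case/forestP: sF => _ H _ _; apply: H; rewrite inE. Qed.
Let tr x y z : x <<= y -> y <<= z -> x <<= z.
Proof. by case/forestP: sF => _ _ H _; apply: H. Qed.
Let lin x y z : x <<= z -> y <<= z -> x <<= y \/ y <<= x.
Proof. by case/forestP: sF => _ _ _ H; apply: H. Qed.

Lemma cover_leP x y :
  reflect (x <<= y /\ forall z, x <<= z -> z <<= y -> z <<= x \/ y <<= z)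
          (cover_le s x y).
Proof.
apply: (iffP andP) => -[xy H]; split=> //.
  by move=> z xz zy; apply/orP; have /forallP/(_ z) := H; rewrite xz zy.
apply/forallP => z; apply/implyP => xz; apply/implyP => zy; apply/orP; exact: H.
Qed.

Lemma cover_adj_sym : symmetric (cover_adj s).
Proof. by move=> x y; rewrite /cover_adj eq_sym orbC. Qed.

Lemma adj_graph_of : adj (graph_of s) =2 cover_adj s.
Proof. exact/adj_edges_of/cover_adj_sym. Qed.

Lemma graph_of_graph : is_graph (graph_of s).
Proof. by apply: edges_of_graph => x; rewrite /cover_adj eqxx. Qed.

Lemma equ_cover x y : equ x y -> cover_le s x y.
Proof. by case/andP=> xy yx; apply/cover_leP; split=> // z xz zy; left; apply: tr yx. Qed.

Lemma equ_cover_adj x y : equ x y -> cover_adj s x y = (x != y).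
Proof. by move=> e; rewrite /cover_adj equ_cover // andbT. Qed.

Lemma cover_equ x x' y y' : equ x x' -> equ y y' -> cover_le s x y -> cover_le s x' y'.
Proof.
move=> /andP[xx' x'x] /andP[yy' y'y] /cover_leP[xy H]; apply/cover_leP; split.
  exact: tr (tr x'x xy) yy'.
move=> z x'z zy'; case: (H z (tr xx' x'z) (tr zy' y'y)) => [zx|yz].
  by left; apply: tr xx'.
by right; apply: tr y'y yz.
Qed.

(** Among the elements between [x] and [y] that are not above [y], one with the most elements below
    it is covered by [y]. [child_exists] is the dual, with the fewest. *)
Lemma parent_exists x y : x <<= y -> ~~ (y <<= x) ->
  exists u, [/\ x <<= u, cover_le s u y & ~~ (y <<= u)].
Proof.
move=> xy yx; pose P u := [&& x <<= u, u <<= y & ~~ (y <<= u)].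
case: (@arg_maxnP _ x P (fun u => #|[set z | z <<= u]|)).
  by rewrite /P rfl xy.
move=> u /and3P[xu uy yu] umax; exists u; split=> //; apply/cover_leP; split=> //.
move=> z uz zy; case: (boolP (y <<= z)) => [|yz]; [by right|left].
have Pz : P z by rewrite /P (tr xu uz) zy yz.
have sub : [set v | v <<= u] \subset [set v | v <<= z].
  by apply/subsetP => v; rewrite !inE => vu; apply: tr uz.
have /eqP e : [set v | v <<= u] == [set v | v <<= z].
  by rewrite eqEcard sub; apply: umax.
have : z \in [set v | v <<= z] by rewrite inE.
by rewrite -e inE.
Qed.

Lemma child_exists x y : x <<= y -> ~~ (y <<= x) ->
  exists u, [/\ u <<= y, cover_le s x u & ~~ (u <<= x)].
Proof.
move=> xy yx; pose P u := [&& x <<= u, u <<= y & ~~ (u <<= x)].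
case: (@arg_minnP _ y P (fun u => #|[set z | z <<= u]|)).
  by rewrite /P rfl xy.
move=> u /and3P[xu uy ux] umin; exists u; split=> //; apply/cover_leP; split=> //.
move=> z xz zu; case: (boolP (z <<= x)) => [|zx]; [by left|right].
have Pz : P z by rewrite /P xz (tr zu uy).
have sub : [set v | v <<= z] \subset [set v | v <<= u].
  by apply/subsetP => v; rewrite !inE => vz; apply: tr zu.
have /eqP e : [set v | v <<= z] == [set v | v <<= u].
  by rewrite eqEcard sub; apply: umin.
have : u \in [set v | v <<= u] by rewrite inE.
by rewrite -e inE.
Qed.

(** A walk from [r] to [y] that stays below [y] avoids every class that is not below [y], which is
    what [le_avoid] needs. *)
Definition downrel (y : V) : rel V :=
  [rel u v | [&& cover_adj s u v, u <<= y & v <<= y]].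

Lemma downrel_connect y : connect (downrel y) r y.
Proof.
have [n] := ubnP #|[set z | z <<= y]|; elim: n y => // n IH y yn.
have step u : u <<= y -> cover_le s u y -> connect (downrel y) u y.
  move=> uy c; have [->//|neq] := eqVneq u y.
  by apply: connect1; rewrite /downrel /= /cover_adj neq c uy rfl.
have [yr|yr] := boolP (y <<= r).
  by apply: step => //; apply: equ_cover; rewrite rmin.
have [u [_ cuy yu]] := parent_exists (rmin y) yr.
have uy : u <<= y by case/cover_leP: cuy.
apply: connect_trans (step u uy cuy).
have {}IH : connect (downrel u) r u.
  apply: IH; rewrite -ltnS; apply: leq_trans yn; rewrite ltnS.
  apply: proper_card; apply/properP; split.
    by apply/subsetP => v; rewrite !inE => vu; apply: tr uy.
  by exists y; rewrite !inE.
apply: connect_sub IH => a b /= /and3P[ab au bu].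
by apply: connect1; rewrite /downrel /= ab (tr au uy) (tr bu uy).
Qed.

Lemma graph_of_connected : is_connected (graph_of s).
Proof.
apply/andP; split; first by apply/card_gt0P; exists r.
have down y : connect (adj (graph_of s)) r y.
  apply: connect_sub (downrel_connect y) => a b /= /and3P[ab _ _].
  by apply: connect1; rewrite adj_graph_of.
apply/forallP => x; apply/forallP => y; apply: connect_trans (down y).
by rewrite (sym_connect_sym (@adj_sym _ _)).
Qed.

Definition avoid (e : rel V) (C : pred V) : rel V :=
  [rel u v | [&& e u v, ~~ C u & ~~ C v]].

(** If [x] is not below [y], the walk of [downrel_connect] avoids the class of [x]. If it is, the
    walk must enter the up-set of [x], and this is possible only through the class of [x]. The root
    class is treated apart because [r] itself lies in it. *)
Lemma le_avoid x y :
  (x <<= y) = (x <<= r) || ~~ connect (avoid (cover_adj s) (fun v => equ x v)) r y.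
Proof.
have [xr|xr] /= := boolP (x <<= r); first exact: tr (rmin y).
apply/idP/idP; last first.
  apply: contraNT => xy; apply: connect_sub (downrel_connect y) => a b /=.
  case/and3P => ab ay by_; apply: connect1; rewrite /avoid /= ab /=.
  by rewrite !negb_and; apply/andP; split; apply/orP; left; apply: contra xy => xz;
    [apply: tr ay | apply: tr by_].
move=> xy; apply/negP => /connectP[p].
(* Invariant: no vertex of the walk is above [x]. If an edge led from [u], not above [x], to [v]
   above [x], then [u] would be below [x], and the cover would force [v] to be equivalent to [x]. *)
have : forall u, ~~ (x <<= u) ->
    path (avoid (cover_adj s) (fun v => equ x v)) u p -> y = last u p -> False.
  elim: p => [|v p IH] u xu /=; first by move=> _ e; rewrite -e xy in xu.
  case/andP => /and3P[uv _ xv] pp; apply: IH pp.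
  apply/negP => xlv; case/negP: xv; rewrite xlv /=.
  case/andP: uv => _ /orP[] /cover_leP[].
    move=> ulv H; case: (lin xlv ulv) => [xlu|ulx]; first by rewrite xlu in xu.
    by case: (H x ulx xlv) => // xlu; rewrite xlu in xu.
  by move=> vlu _; rewrite (tr xlv vlu) in xu.
by move=> /(_ r xr).
Qed.

(* There are at least three blocks, i.e. the graph is not complete. *)
Definition spread : bool := ~~ total_on (~: root_block s) s.

Lemma not_root_block x : (x \in ~: root_block s) = ~~ (x <<= r).
Proof.
rewrite !inE; congr negb; apply/forallP/idP => [//|xr y].
exact: tr (rmin y).
Qed.

Lemma spreadP : reflect (exists a b, [/\ ~~ (a <<= r), ~~ (b <<= r) & ~~ (a <<= b)]) spread.
Proof.
apply: (iffP negP) => [H|[a [b [ar br ab]]] /total_onP H].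
  apply: contrapT => nex; apply: H; apply/total_onP => x y.
  rewrite !not_root_block => xr yr; apply: contrapT => /negP xy.
  by apply: nex; exists x, y.
by have := H a b; rewrite !not_root_block (negbTE ab) => /(_ ar br).
Qed.

Lemma incomparable_cover_adj x y : ~~ (x <<= y) -> ~~ (y <<= x) -> cover_adj s x y = false.
Proof.
move=> xy yx; apply/negP => /andP[_ /orP[] /cover_leP[H _]].
  by rewrite H in xy.
by rewrite H in yx.
Qed.

Lemma between_cover_adj x y z : x <<= y -> ~~ (y <<= x) -> y <<= z -> ~~ (z <<= y) ->
  cover_adj s x z = false.
Proof.
move=> xy yx yz zy; apply/negP => /andP[_ /orP[] /cover_leP[xz H]].
  by case: (H y xy yz) => h; [rewrite h in yx|rewrite h in zy].
by rewrite (tr xz xy) in zy.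
Qed.

(** If [x] is outside the root block, its parent is adjacent to [x] but not to [y]. Otherwise let
    [a] and [b] witness [spread]. If one of them is not above [y], the child of [x] towards it is
    incomparable with [y]. If both are above [y], then [a] is strictly above [y], since [a] is not
    below [b], and the child of [y] towards [a] is not adjacent to [x]. *)
Lemma cover_twin_free x y : spread -> cover_le s x y -> ~~ (y <<= x) ->
  exists z, [/\ z != x, z != y & cover_adj s x z != cover_adj s y z].
Proof.
move=> /spreadP[a [b [ar br ab]]] /cover_leP[xy H] yx.
have neq u v : ~~ (u <<= v) -> v != u by apply: contraNneq => ->.
have strictly u v : cover_le s u v -> ~~ (v <<= u) -> cover_adj s u v.
  by move=> c n; rewrite /cover_adj c (neq _ _ n).
have [xr|xr] := boolP (x <<= r); last first.
  have [u [ru cux xu]] := parent_exists (rmin x) xr.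
  have ux : u <<= x by case/cover_leP: cux.
  exists u; split; first exact: neq.
    by apply: neq; apply: contra xu; exact: tr.
  rewrite [cover_adj s y u]cover_adj_sym (between_cover_adj ux xu xy yx).
  by rewrite [cover_adj s x u]cover_adj_sym (strictly _ _ cux xu).
have xmin v : x <<= v := tr xr (rmin v).
have notbelow v : ~~ (v <<= r) -> ~~ (v <<= x).
  by apply: contra => vx; apply: tr xr.
have [ayb|] := boolP (y <<= a); last first.
  move=> ya; have [z [za cxz zx]] := child_exists (xmin a) (notbelow a ar).
  have xz := xmin z.
  have yz : ~~ (y <<= z) by apply: contra ya => yz; apply: tr za.
  have zy : ~~ (z <<= y).
    apply: contra yz => zy.
    by case: (H z xz zy) => // zx'; rewrite zx' in zx.
  exists z; split; first by rewrite eq_sym neq.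
    by rewrite eq_sym neq.
  by rewrite (incomparable_cover_adj yz zy) (strictly _ _ cxz zx).
have [yb|yb] := boolP (y <<= b); last first.
  have [z [zb cxz zx]] := child_exists (xmin b) (notbelow b br).
  have xz := xmin z.
  have yz : ~~ (y <<= z) by apply: contra yb => yz; apply: tr zb.
  have zy : ~~ (z <<= y).
    apply: contra yz => zy.
    by case: (H z xz zy) => // zx'; rewrite zx' in zx.
  exists z; split; first by rewrite eq_sym neq.
    by rewrite eq_sym neq.
  by rewrite (incomparable_cover_adj yz zy) (strictly _ _ cxz zx).
have ay : ~~ (a <<= y) by apply: contra ab => ay; apply: tr yb.
have [z [za cyz zy]] := child_exists ayb ay.
have yz : y <<= z by case/cover_leP: cyz.
exists z; split; first by rewrite eq_sym neq //; apply: contra yx => zx; apply: tr zx.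
  by rewrite eq_sym neq.
by rewrite (between_cover_adj xy yx yz zy) (strictly _ _ cyz zy).
Qed.

(** Equivalent vertices have the same covers, hence are adjacent twins; conversely [cover_twin_free]
    separates the ends of a strict cover. The right-hand side depends on the adjacency only. *)
Lemma equ_twin x y : spread ->
  equ x y = (x == y) ||
    cover_adj s x y && [forall z, (z != x) ==> (z != y) ==> (cover_adj s x z == cover_adj s y z)].
Proof.
move=> sp; apply/idP/idP.
  move=> e; have [->//|xy] /= := eqVneq x y; rewrite equ_cover_adj // xy /=.
  apply/forallP => z; apply/implyP => zx; apply/implyP => zy.
  rewrite /cover_adj ![_ == z]eq_sym zx zy /=; apply/eqP.
  have e' : equ y x by rewrite andbC.
  have ez : equ z z by rewrite !rfl.
  by apply/orP/orP => -[] c; [left|right|left|right];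
    first [exact: cover_equ e ez c | exact: cover_equ ez e c |
           exact: cover_equ e' ez c | exact: cover_equ ez e' c].
case/orP => [/eqP->|/andP[xy /forallP H]]; first by rewrite !rfl.
apply: contraT => nxy; case/andP: xy => _ /orP[] c.
  have cle : x <<= y by case/cover_leP: c.
  rewrite cle /= in nxy; have [z [zx zy]] := cover_twin_free sp c nxy.
  by have := H z; rewrite zx zy => /= /eqP ->; rewrite eqxx.
have cle : y <<= x by case/cover_leP: c.
rewrite cle andbT in nxy; have [z [zx zy]] := cover_twin_free sp c nxy.
by have := H z; rewrite zx zy => /= /eqP ->; rewrite eqxx.
Qed.

Lemma spread_not_complete : spread -> exists x y, (x != y) && ~~ cover_adj s x y.
Proof.
case/spreadP => a [b [ar br ab]].
have [ba|ba] := boolP (b <<= a).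
  exists r, a; rewrite (between_cover_adj (rmin b) br ba ab) andbT.
  by apply: contraNneq ar => <-.
exists a, b; rewrite incomparable_cover_adj // andbT.
by apply: contraNneq ab => <-.
Qed.

(** There are at most two blocks, the root block and one covering it. *)
Lemma not_spread_complete : ~~ spread -> forall x y, cover_adj s x y = (x != y).
Proof.
move=> nsp.
have nonroot a b : ~~ (a <<= r) -> ~~ (b <<= r) -> a <<= b.
  move=> ar br; apply: contraNT nsp => ab; apply/spreadP; by exists a, b.
have root_cover x y : x <<= r -> cover_le s x y.
  move=> xr; apply/cover_leP; split=> [|z xz zy]; first exact: tr (rmin y).
  have [zr|zr] := boolP (z <<= r); first by left; apply: tr zr (tr (rmin x) (rfl x)).
  right; have [yr|yr] := boolP (y <<= r); last exact: nonroot.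
  by rewrite (tr zy yr) in zr.
move=> x y; have [xr|xr] := boolP (x <<= r).
  by rewrite /cover_adj root_cover // andbT.
have [yr|yr] := boolP (y <<= r).
  by rewrite /cover_adj (root_cover y x) // orbT andbT.
by apply: equ_cover_adj; apply/andP; split; apply: nonroot.
Qed.

End Graph.

(** [equ_twin] reads the classes off the graph and [le_avoid] then reads off the order; being below
    the minimum [r] amounts to being equivalent to it. *)
Lemma graph_of_inj (V : finType) (r : V) (s t : {set V * V}) :
  forest setT s -> forest setT t -> (forall y, (r, y) \in s) ->
  (forall y, (r, y) \in t) -> spread s -> spread t ->
  graph_of s = graph_of t -> s = t.
Proof.
move=> sF tF sr tr ss ts e.
have ec x y : cover_adj s x y = cover_adj t x y by rewrite -!adj_graph_of e.
have equE x y : ((x, y) \in s) && ((y, x) \in s) = ((x, y) \in t) && ((y, x) \in t).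
  rewrite (equ_twin sF sr) // (equ_twin tF tr) // ec; congr (_ || _ && _).
  by apply: eq_forallb => z; rewrite !ec.
apply/setP => -[x y]; rewrite (le_avoid sF sr) (le_avoid tF tr).
have rE : ((x, r) \in s) = ((x, r) \in t) by have := equE x r; rewrite sr tr !andbT.
rewrite rE; congr (_ || ~~ _); apply: eq_connect => u v.
by rewrite /avoid /= ec !equE.
Qed.

Lemma cover_le_push (V W : finType) (f : W -> V) (s : {set W * W}) a b : injective f ->
  f @: setT = setT -> cover_le (push f s) (f a) (f b) = cover_le s a b.
Proof.
move=> fI fT; rewrite /cover_le in_push //; congr (_ && _).
have fs x : exists a, x = f a.
  by have /imsetP[c _ ->] : x \in f @: setT; [rewrite fT inE | exists c].
apply/forallP/forallP => [H c|H x]; first by have := H (f c); rewrite !in_push.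
by have [c ->] := fs x; rewrite !in_push.
Qed.

(** * Leaf roots *)

(** Without a walk [gdist] returns [#|V|]; the bound on [k] keeps this default from passing for a
    small distance. *)
Lemma gdist_le (V : finType) (G : {set {set V}}) x y k : k < #|V| ->
  reflect (exists p, [/\ path (adj G) x p, last x p = y & size p <= k])
          (gdist G x y <= k).
Proof.
move=> kV; rewrite /gdist -ltnS -has_take_leq ?size_iota //.
rewrite take_iota (minn_idPl kV).
apply: (iffP hasP) => [[i + /existsP[p /andP[pp /eqP lp]]]|[p [pp lp sp]]].
  by rewrite mem_iota => ik; exists p; rewrite size_tuple.
exists (size p); first by rewrite mem_iota.
by apply/existsP; exists (in_tuple p); rewrite pp lp eqxx.
Qed.

(** * Trees given by a parent function *)

Section ParentTree.
Variables (T : finType) (par : T -> T) (d : T -> nat) (root : T).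
Hypothesis dlt : forall x, x != root -> d (par x) < d x.
Hypothesis proot : par root = root.

Definition parent_rel : rel T := fun x y => (x != y) && ((par x == y) || (par y == x)).

Lemma parent_rel_sym : symmetric parent_rel.
Proof. by move=> x y; rewrite /parent_rel eq_sym orbC. Qed.

Lemma parent_rel_down x y : parent_rel x y -> d y <= d x -> par x = y.
Proof.
move=> /andP[xy /orP[/eqP//|/eqP e]] dyx; exfalso.
have [yr|yr] := eqVneq y root; first by rewrite yr proot -yr in e; rewrite e eqxx in xy.
by have := dlt yr; rewrite e ltnNge dyx.
Qed.

(** On a cycle take a vertex of maximal depth: both of its neighbors on the cycle must be its
    parent, so they coincide. *)
Lemma parent_tree : is_tree (edges_of parent_rel).
Proof.
have adjE := adj_edges_of parent_rel_sym; split.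
- by apply: edges_of_graph => x; rewrite /parent_rel eqxx.
- apply/andP; split; first by apply/card_gt0P; exists root.
  have H x : connect (adj (edges_of parent_rel)) root x.
    have [n] := ubnP (d x); elim: n x => // n IH x xn.
    have [->//|xr] := eqVneq x root.
    have lt := dlt xr; apply: connect_trans (IH (par x) (leq_trans lt xn)) _.
    apply: connect1; rewrite adjE /parent_rel eqxx orbT andbT.
    by apply: contraTneq lt => ->; rewrite ltnn.
  apply/forallP => x; apply/forallP => y; apply: connect_trans (H y).
  by rewrite (sym_connect_sym (@adj_sym _ _)).
move=> c c2; apply/negP => /andP[cc uc].
have [x0 x0c] : exists x, x \in c by case: c c2 {cc uc} => // x; exists x; rewrite mem_head.
have [x xc xmax] := @arg_maxnP _ x0 (mem c) d x0c.
have [i c' Ec] := rot_to xc; have c'2 : 1 < size c'.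
  by move: c2; rewrite -(size_rot i) Ec.
move: cc uc; rewrite -(rot_cycle i) -(rot_uniq i) Ec /=.
case/lastP: c' Ec c'2 => // c' z; case: c' => // y c' Ec _.
rewrite rcons_path last_rcons /= => /andP[/andP[xy _] zx] /and3P[_ yu _].
have mc u : u \in x :: rcons (y :: c') z -> d u <= d x.
  by rewrite -Ec mem_rot; apply: xmax.
have py : par x = y.
  by apply: parent_rel_down; [rewrite -adjE|apply: mc; rewrite !inE eqxx orbT].
have pz : par x = z.
  apply: parent_rel_down; first by rewrite parent_rel_sym -adjE.
  by apply: mc; rewrite inE mem_rcons mem_head orbT.
by move: yu; rewrite -py pz mem_rcons mem_head.
Qed.

End ParentTree.

(** * A leaf root for the graph of a tree preorder *)

Section LeafRoot.
Variables (V : finType) (s : {set V * V}) (r : V).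
Hypothesis sF : forest setT s.
Hypothesis rmin : forall y, (r, y) \in s.
Hypothesis V1 : 1 < #|V|.

Notation "x <<= y" := ((x, y) \in s) (at level 70).
Notation equ x y := ((x <<= y) && (y <<= x)).

Let rfl x : x <<= x. Proof. by case/forestP: sF => _ H _ _; apply: H; rewrite inE. Qed.
Let tr x y z : x <<= y -> y <<= z -> x <<= z.
Proof. by case/forestP: sF => _ _ H _; apply: H. Qed.
Let lin x y z : x <<= z -> y <<= z -> x <<= y \/ y <<= x.
Proof. by case/forestP: sF => _ _ _ H; apply: H. Qed.

(** [pick] sees only the extension of its predicate, so equivalent vertices get the same
    representative. *)
Definition rep (x : V) : V := odflt x [pick y | equ x y].

Lemma rep_equ x : equ x (rep x).
Proof. by rewrite /rep; case: pickP => //= _; rewrite !rfl. Qed.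

Lemma equ_rep x y : equ x y -> rep x = rep y.
Proof.
case/andP=> xy yx; rewrite /rep.
have e z : equ x z = equ y z.
  by apply/andP/andP => -[h1 h2]; split; first [exact: tr xy h1|exact: tr yx h1|exact: tr h2 _].
rewrite (eq_pick e); case: pickP => // /(_ y); by rewrite !rfl.
Qed.

Lemma repP x y : (rep x == rep y) = equ x y.
Proof.
apply/eqP/idP => [e|/equ_rep//].
have /andP[h1 h2] := rep_equ x; have /andP[h3 h4] := rep_equ y.
by rewrite e in h1 h2; rewrite (tr h1 h4) (tr h3 h2).
Qed.

Lemma rep_rep x : rep (rep x) == rep x.
Proof. by rewrite repP andbC rep_equ. Qed.

Definition block_rep : finType := {x : V | rep x == x}.
Definition brep (x : V) : block_rep := exist _ (rep x) (rep_rep x).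

Lemma brepP x y : (brep x == brep y) = equ x y.
Proof. by rewrite -val_eqE /= repP. Qed.

Lemma brep_val b : brep (val b) = b.
Proof. by apply/val_inj/eqP; rewrite /= (valP b). Qed.

(** Determined only up to equivalence. In the root block there is no candidate, and the default [y]
    makes the root block its own parent, as [parent_tree] requires. *)
Definition parent (y : V) : V := odflt y [pick u | cover_le s u y && ~~ (y <<= u)].

Lemma parentP y : ~~ (y <<= r) -> cover_le s (parent y) y /\ ~~ (y <<= parent y).
Proof.
move=> yr; rewrite /parent; case: pickP => [u /andP[]//|no].
have [u [_ cuy yu]] := parent_exists sF (rmin y) yr.
by have := no u; rewrite cuy yu.
Qed.

Lemma parent_root y : y <<= r -> parent y = y.
Proof.
move=> yr; rewrite /parent; case: pickP => // u /andP[_ /negP[]].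
exact: tr yr (rmin u).
Qed.

Lemma parent_uniq u y : cover_le s u y -> ~~ (y <<= u) -> equ u (parent y).
Proof.
move=> c yu; have yr : ~~ (y <<= r) by apply: contra yu => h; apply: tr h (rmin u).
have [/cover_leP[py H] ypy] := parentP yr.
have /cover_leP[uy H'] := c.
have [up|pu] := lin uy py.
  by case: (H' _ up py) => [->|h]; [rewrite up|rewrite h in ypy].
by case: (H _ pu uy) => [->|h]; [rewrite pu|rewrite h in yu].
Qed.

(** Each vertex hangs as a leaf from its block, and each block from its parent block. Distinct
    leaves are then at distance 2 within a block and 3 between adjacent blocks. *)
Definition lnode : finType := (V + block_rep)%type.

Definition lpar (t : lnode) : lnode :=
  match t with inl x => inr (brep x) | inr b => inr (brep (parent (val b))) end.

(** A leaf must be deeper than every block, and the depth of a block is a number of vertices, at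
    most [#|V|]. *)
Definition ldepth (t : lnode) : nat :=
  match t with inl x => #|V|.+1 | inr b => #|[set z | z <<= val b]| end.

Definition ltree : {set {set lnode}} := edges_of (parent_rel lpar).

Let adjE := adj_edges_of (@parent_rel_sym lnode lpar).

Lemma ltree_tree : is_tree ltree.
Proof.
apply: (@parent_tree _ _ ldepth (inr (brep r))) => [[x|b] /= bx|] /=.
- by rewrite ltnS max_card.
- have br : ~~ (val b <<= r).
    apply: contra bx => br; rewrite -(brep_val b); apply/eqP; congr inr.
    by apply/eqP; rewrite brepP br rmin.
  have [/cover_leP[pb _] bp] := parentP br.
  have /andP[h1 h2] := rep_equ (parent (val b)).
  apply: proper_card; apply/properP; split.
    by apply/subsetP => v; rewrite !inE => vr; apply: tr pb; apply: tr h2.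
  exists (val b); rewrite !inE ?rfl //.
  by apply: contra bp => h; apply: tr h h2.
congr inr; apply/eqP; rewrite brepP.
have rr : rep r <<= r by case/andP: (rep_equ r).
by rewrite parent_root // rr rmin.
Qed.

Lemma adj_leaf x t : adj ltree (inl x) t = (t == inr (brep x)).
Proof.
rewrite adjE /parent_rel /=; case: t => [y|b] /=; first by rewrite andbC.
by rewrite [X in _ || X](_ : _ = false) // orbF eq_sym.
Qed.

Lemma adj_block b c : adj ltree (inr b) (inr c) =
  (b != c) && (cover_le s (val b) (val c) || cover_le s (val c) (val b)).
Proof.
have H b' c' : b' != c' -> (brep (parent (val b')) == c') = cover_le s (val c') (val b').
  rewrite -{1}(brep_val b') -{1}(brep_val c') brepP => bc.
  have [br|br] := boolP (val b' <<= r).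
    have cb' : ~~ (val c' <<= val b').
      by apply: contra bc => h; rewrite h (tr br (rmin _)).
    rewrite parent_root // brep_val -{1}(brep_val b') -{1}(brep_val c') brepP (negbTE bc).
    by apply/esym/negP => /cover_leP[h _]; rewrite h in cb'.
  have [cb bp] := parentP br.
  rewrite -{1}(brep_val c') brepP; apply/idP/idP => [e|c1].
    by apply: (cover_equ sF _ _ cb) => //; rewrite !rfl.
  rewrite andbC; apply: parent_uniq => //; apply: contra bc => h; rewrite h.
  by case/cover_leP: c1.
have inrE (x y : block_rep) : ((inr x : lnode) == inr y) = (x == y) by [].
rewrite adjE /parent_rel /= !inrE; have [//|bc] /= := eqVneq b c.
by rewrite H // H 1?eq_sym // orbC.
Qed.

Lemma strict_cover_exists x y : x <<= y -> ~~ (y <<= x) -> exists2 z, cover_le s x z & ~~ (z <<= x).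
Proof. by move=> xy yx; have [z [_]] := child_exists sF xy yx; exists z. Qed.

(** A block [b] carries the leaf [val b]. If that were its only neighbor, no block would be adjacent
    to it, so all vertices would lie in [b], and a second vertex would be a second neighbor. *)
Lemma ltree_leaves : [set inl x | x : V] = leaves ltree.
Proof.
apply/setP => -[x|b]; rewrite inE.
  rewrite mem_imset ?inE; last by move=> ? ? [].
  apply/esym; rewrite (_ : [set y | _] = [set inr (brep x)]) ?cards1 //.
  by apply/setP => t; rewrite !inE adj_leaf.
rewrite (_ : _ \in _ = false); last by apply/imsetP => -[].
apply/esym/negP => /cards1P[t /setP Et].
have leaf y : brep y == b -> inl y = t.
  move=> /eqP e; have := Et (inl y).
  by rewrite !inE adj_sym adj_leaf e eqxx => /esym/eqP.
have e1 := leaf (val b); rewrite brep_val eqxx in e1; have {}e1 := e1 isT.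
have noblock c : adj ltree (inr b) (inr c) = false.
  by have := Et (inr c); rewrite !inE -e1.
have same x : equ x (val b).
  rewrite -brepP brep_val; apply: contraT => xb.
  have [br|br] := boolP (val b <<= r); last first.
    have [c bp] := parentP br; have := noblock (brep (parent (val b))).
    rewrite adj_block -{1}(brep_val b) brepP (negbTE bp) /=.
    move/negbT; rewrite negb_or => /andP[_ /negP[]].
    apply: (cover_equ sF (rep_equ _) _ c); by rewrite !rfl.
  have bx := tr br (rmin x).
  have nxb : ~~ (x <<= val b).
    by apply: contra xb => h; rewrite -(brep_val b) brepP h.
  have [z c zb] := strict_cover_exists bx nxb; have := noblock (brep z).
  rewrite adj_block -{1}(brep_val b) brepP (negbTE zb) andbF /=.
  by move/negbT; rewrite negb_or => /andP[/negP[]]; apply: (cover_equ sF _ (rep_equ z) c); rewrite !rfl.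
have [x xb] : exists x, x != val b.
  apply/existsP; apply: contraTT V1; rewrite negb_exists => /forallP H.
  rewrite -leqNgt -(card1 (val b)); apply/subset_leq_card/subsetP => x _.
  by rewrite inE; have := H x; rewrite negbK.
have : inl x = t by apply: leaf; rewrite -(brep_val b) brepP.
by rewrite -e1 => -[e]; rewrite e eqxx in xb.
Qed.

Lemma graph_of_leaf_power : 2 < #|V| -> leaf_power 3 (graph_of s).
Proof.
move=> V2; exists lnode, ltree, inl; split.
- exact: ltree_tree.
- by move=> ? ? [].
- by rewrite -ltree_leaves; apply/setP => t; apply/imsetP/imsetP => -[x _ ->]; exists x.
(* More than two leaves and at least one block: the bound that [gdist_le] asks for at [k = 3]. *)
have lV : 3 < #|lnode|.
  rewrite card_sum -addn1 leq_add //; by apply/card_gt0P; exists (brep r).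
move=> x y xy; rewrite adj_graph_of /cover_adj xy /=.
have cE : cover_le s x y || cover_le s y x =
    (brep x == brep y) || adj ltree (inr (brep x)) (inr (brep y)).
  rewrite adj_block; have [/eqP e|ne] /= := eqVneq (brep x) (brep y).
    by rewrite brepP in e; rewrite equ_cover.
  have ex := rep_equ x; have ey := rep_equ y.
  have ex' : equ (rep x) x by rewrite andbC.
  have ey' : equ (rep y) y by rewrite andbC.
  by congr (_ || _); apply/idP/idP; apply: cover_equ.
rewrite cE; apply/idP/gdist_le => //.
  case/orP => [/eqP e|a].
    exists [:: inr (brep x); inl y]; split=> //=.
    by rewrite adj_leaf eqxx adj_sym adj_leaf e eqxx.
  exists [:: inr (brep x); inr (brep y); inl y]; split=> //=.
  by rewrite adj_leaf eqxx a adj_sym adj_leaf eqxx.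
case=> -[|t1 [|t2 [|t3 [|t4 p]]]] [] //=.
- by move=> _ [e]; rewrite e eqxx in xy.
- by rewrite andbT adj_leaf => /eqP ->.
- rewrite adj_leaf => /and3P[/eqP-> a _] e; move: a; rewrite e adj_sym adj_leaf.
  by move=> /eqP[e3]; rewrite -val_eqE /= e3 eqxx.
rewrite adj_leaf => /and4P[/eqP-> a b _] e; move: b; rewrite e adj_sym adj_leaf.
by move=> /eqP e2 _; rewrite -e2 a orbT.
Qed.

End LeafRoot.

(** * From a leaf root to a tree preorder *)

Lemma prefix_rconsE (T : eqType) (q s : seq T) x :
  prefix q (rcons s x) = (q == rcons s x) || prefix q s.
Proof.
apply/idP/orP => [/prefixP[w]|[/eqP->|qs]]; last 2 first.
- exact: prefix_refl.
- exact: prefix_trans qs (prefix_rcons s x).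
case/lastP: w => [|w y]; first by rewrite cats0 => ->; left.
rewrite -rcons_cat => /rcons_inj[-> _]; right; exact: prefix_prefix.
Qed.

Lemma prefix_lin (T : eqType) (p q s : seq T) :
  prefix p s -> prefix q s -> prefix p q \/ prefix q p.
Proof.
move=> /prefixP[w ->]; rewrite !prefixE take_cat; case: ltnP => [lt|le] /eqP <-.
  by right; rewrite size_takel // ltnW.
by left; rewrite take_size_cat.
Qed.

Lemma prefix_anti (T : eqType) (p q : seq T) : prefix p q -> prefix q p -> p = q.
Proof.
move=> /prefixP[w ->] /size_prefix; rewrite size_cat -leq_subRL // subnn leqn0.
by move=> /nilP->; rewrite cats0.
Qed.

Section TreePaths.
Variables (T : finType) (E : {set {set T}}).
Hypothesis ET : is_tree E.

(* Two such paths parting at x into a and b would give a cycle through x, as a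
   and b are still connected when x is removed. *)
Lemma tree_path_uniq x p q : path (adj E) x p -> uniq (x :: p) ->
  path (adj E) x q -> uniq (x :: q) -> last x p = last x q -> p = q.
Proof.
elim: p x q => [|a p IH] x [|b q] //=.
- by move=> _ _ _ /andP[+ _] e; rewrite e mem_last.
- by move=> _ /andP[+ _] _ _ e; rewrite -e mem_last.
move=> /andP[xa ap] /andP[xap uap] /andP[xb bq] /andP[xbq ubq] e.
have [ab|ab] := eqVneq a b.
  by subst b; congr cons; apply: IH e.
exfalso; pose e' := [rel u v | [&& adj E u v, u != x & v != x]].
have e'S : symmetric e'.
  by move=> u v; rewrite /= adj_sym; congr (_ && _); rewrite andbC.
have lift c w : x \notin c :: w -> path (adj E) c w -> path e' c w.
  elim: w c => //= d w IHw c; rewrite !inE !negb_or => /and3P[xc xd xw] /andP[cd dw].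
  rewrite cd eq_sym xc eq_sym xd /=; apply: IHw => //.
  by rewrite inE negb_or xd.
have cab : connect e' a b.
  apply: (@connect_trans _ _ (last a p)); first by apply/connectP; exists p; rewrite ?lift.
  rewrite (sym_connect_sym e'S) e; apply/connectP; exists q; rewrite ?lift //.
case/connectP: cab => w /shortenP[w' w'p w'u _] lw.
have [_ _ /(_ (x :: a :: w'))] := ET.
have xw' : x \notin w'.
  elim: w' (a) w'p {w'u lw} => //= c w' IHw d /andP[/and3P[_ _ cx] /IHw].
  by rewrite inE negb_or eq_sym cx.
have ew' : path (adj E) a w' by apply: sub_path w'p => u v /= /and3P[].
case: w' w'u lw w'p xw' ew' => [|c w'] w'u lw w'p xw' ew'; first by rewrite lw eqxx in ab.
move=> /(_ isT)/negP; apply; apply/andP; split.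
  have -> : path.cycle (adj E) [:: x, a, c & w'] =
    path (adj E) x (rcons [:: a, c & w'] x) by [].
  rewrite rcons_path adj_sym; move: lw ew' => /= <- ->; by rewrite xa xb.
rewrite cons_uniq w'u andbT inE negb_or xw' andbT.
by move: xap; rewrite inE negb_or => /andP[].
Qed.

Variable root : T.
Variable P : T -> seq T.
Hypothesis PP : forall t, [/\ path (adj E) root (P t), uniq (root :: P t) & last root (P t) = t].

Lemma root_path_inj t u : P t = P u -> t = u.
Proof. by move=> e; have [_ _ <-] := PP t; have [_ _ <-] := PP u; rewrite e. Qed.

Lemma root_path_eq p : path (adj E) root p -> uniq (root :: p) -> P (last root p) = p.
Proof. by move=> pp up; have [h1 h2 h3] := PP (last root p); apply: tree_path_uniq h3. Qed.

Lemma root_path_prefix t u : u \in root :: P t -> prefix (P u) (P t).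
Proof.
have [pp up lp] := PP t => ut; case/splitPl: ut pp up {lp} => p1 p2 lp1.
rewrite cat_path -cat_cons cat_uniq => /andP[pp1 _] /andP[up1 _].
by rewrite -lp1 root_path_eq ?prefix_prefix.
Qed.

(** If [u] is not on the path to [t], appending [u] gives the path to [u]. If each is on the path to
    the other, the two paths are prefixes of each other, so [t = u], which is no edge. *)
Lemma root_path_step t u : adj E t u -> P u = rcons (P t) u \/ P t = rcons (P u) t.
Proof.
move=> tu; have ext a b : adj E a b -> b \notin root :: P a -> P b = rcons (P a) b.
  move=> ab bn; have [pp up lp] := PP a.
  have := @root_path_eq (rcons (P a) b); rewrite last_rcons; apply.
    by rewrite rcons_path pp lp.
  by rewrite -rcons_cons rcons_uniq bn.
have [h1|h1] := boolP (u \in root :: P t); last by left; apply: ext.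
have [h2|h2] := boolP (t \in root :: P u); last by right; apply: ext; rewrite // adj_sym.
have := root_path_inj (prefix_anti (root_path_prefix h1) (root_path_prefix h2)).
by move=> e; have [gE _ _] := ET; rewrite e adj_irr in tu.
Qed.

Lemma root_path_adj t u a : P u = rcons (P t) a -> adj E t u.
Proof.
move=> e; have [+ _ +] := PP u; rewrite e rcons_path last_rcons => /andP[_] + <-.
by have [_ _ ->] := PP t.
Qed.

Lemma root_path_root : P root = [::].
Proof. exact: (@root_path_eq [::]). Qed.

End TreePaths.

Lemma root_paths_exist (T : finType) (E : {set {set T}}) (root : T) : is_tree E ->
  exists P : T -> seq T, forall t,
    [/\ path (adj E) root (P t), uniq (root :: P t) & last root (P t) = t].
Proof.
case=> _ /andP[_ /forallP/(_ root)/forallP ct] _.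
suff /choice[P PP] : forall t, exists p,
    [/\ path (adj E) root p, uniq (root :: p) & last root p = t] by exists P.
by move=> t; have /connectP[p /shortenP[p' pp up _] ->] := ct t; exists p'.
Qed.

Section LeafPower.
Variables (V : finType) (G : {set {set V}}) (r : V).
Hypothesis gG : is_graph G.
Hypothesis cG : is_connected G.
Hypothesis V2 : 2 < #|V|.
Variables (T : finType) (E : {set {set T}}) (f : V -> T).
Hypothesis ET : is_tree E.
Hypothesis fI : injective f.
Hypothesis fL : f @: setT = leaves E.
Hypothesis adjG : forall x y, x != y -> adj G x y = (gdist E (f x) (f y) <= 3).

Definition support (x : V) : T := odflt (f x) [pick t | adj E (f x) t].

Lemma support_adj x t : adj E (f x) t = (t == support x).
Proof.
have : f x \in leaves E by rewrite -fL imset_f.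
rewrite inE => /cards1P[u /setP Eu].
have {}Eu t' : adj E (f x) t' = (t' == u) by have := Eu t'; rewrite !inE.
rewrite /support; case: pickP => [v|no]; first by rewrite !Eu => /eqP->.
by have := no u; rewrite Eu eqxx.
Qed.

(** Two adjacent leaves would form the whole tree, leaving room for only two vertices of the graph.
    This is where size 2 has to be excluded. *)
Lemma support_nonleaf x y : support x != f y.
Proof.
apply/eqP => e; have xy : adj E (f x) (f y) by rewrite support_adj e.
have sy : support y = f x by apply/esym/eqP; rewrite -support_adj adj_sym.
have [_ /andP[_ /forallP/(_ (f x))/forallP ct] _] := ET.
have cl : closed (adj E) (pred2 (f x) (f y)).
  apply: intro_closed => [|u v uv /orP[/eqP ux|/eqP uy]]; first exact/sym_connect_sym/adj_sym.
    by move: uv; rewrite ux support_adj e inE => ->; rewrite orbT.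
  by move: uv; rewrite uy support_adj sy inE => ->.
move: V2; rewrite ltnNge => /negP; apply.
have : f @: setT \subset [set f x; f y].
  apply/subsetP => t _; rewrite !inE; have := closed_connect cl (ct t).
  by rewrite !inE eqxx /= => <-.
move/subset_leq_card; rewrite card_imset // cardsT => /leq_trans; apply.
by rewrite cards2; case: (_ != _).
Qed.

Lemma card_tree_gt3 : 3 < #|T|.
Proof.
have : support r |: f @: setT \subset setT by apply: subsetT.
move/subset_leq_card; rewrite cardsU1 card_imset // !cardsT; apply: leq_trans.
rewrite (_ : _ \notin _) ?add1n //; apply/imsetP => -[y _ e].
by have := support_nonleaf r y; rewrite e eqxx.
Qed.

Lemma adj_support x y : x != y ->
  adj G x y = (support x == support y) || adj E (support x) (support y).
Proof.
move=> xy; rewrite adjG //; apply/(gdist_le _ _ _ card_tree_gt3)/orP.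
  case=> -[|t1 [|t2 [|t3 [|t4 p]]]] [] //=.
  - by move=> _ /fI e; rewrite e eqxx in xy.
  - rewrite andbT support_adj => /eqP-> e.
    by have := support_nonleaf x y; rewrite e eqxx.
  - rewrite support_adj => /and3P[/eqP-> a _] e; move: a; rewrite e adj_sym support_adj.
    by left.
  rewrite support_adj => /and4P[/eqP-> a b _] e; move: b; rewrite e adj_sym support_adj.
  by move=> /eqP <- _; right.
case=> [/eqP e|a].
  exists [:: support x; f y]; split=> //=.
  by rewrite support_adj eqxx adj_sym support_adj e eqxx.
exists [:: support x; support y; f y]; split=> //=.
by rewrite support_adj eqxx a adj_sym support_adj eqxx.
Qed.

(** The obstacle is that the tree may have inner nodes supporting no leaf, which could leave gaps
    between consecutive addresses in the prefix order. Connectedness of [G] rules this out: every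
    prefix of an address is an address ([closed]), so covers are extensions by one letter, that is,
    edges between supports. *)
Lemma leaf_root_preorder : exists s : {set V * V},
  [/\ forest setT s, forall y, (r, y) \in s & graph_of s = G].
Proof.
have [P PP] := root_paths_exist (support r) ET.
pose ad x := P (support x); pose s := [set p : V * V | prefix (ad p.1) (ad p.2)].
have sE x y : ((x, y) \in s) = prefix (ad x) (ad y) by rewrite inE.
have adr : ad r = [::] by apply: (root_path_root ET PP).
have ad_inj x y : ad x = ad y -> support x = support y by apply: root_path_inj.
have sF : forest setT s.
  apply/forestP; split=> //; first by move=> x _; rewrite sE prefix_refl.
    by move=> x y z; rewrite !sE; apply: prefix_trans.
  by move=> x y z; rewrite !sE; apply: prefix_lin.
exists s; split=> // [y|]; first by rewrite sE adr prefix0s.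
(* An edge of [G] changes an address by at most one final letter, so the property that all prefixes
   are addresses passes along walks. *)
have walk p u : path (adj G) u p ->
    (forall q, prefix q (ad u) -> exists z, ad z = q) ->
    forall q, prefix q (ad (last u p)) -> exists z, ad z = q.
  elim: p u => [|v p IH] u //= /andP[uv pp] H; apply: IH pp _ => q.
  have [uv'|ne] := eqVneq u v; first by rewrite -uv'; apply: H.
  move: uv; rewrite adj_support // => /orP[/eqP e|/(root_path_step ET PP)[] e].
  - by rewrite /ad -e; apply: H.
  - rewrite /ad e prefix_rconsE => /orP[/eqP->|/H//]; by exists v; rewrite /ad e.
  by move=> h; apply: H; rewrite /ad e prefix_rconsE; apply/orP; right.
have closed y q : prefix q (ad y) -> exists z, ad z = q.
  have /andP[_ /forallP/(_ r)/forallP/(_ y)/connectP[p pp ->]] := cG.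
  by apply: walk pp _ _ => q'; rewrite adr prefixs0 => /eqP->; exists r.
apply: graph_ext => // [|x y]; first exact: graph_of_graph.
rewrite adj_graph_of /cover_adj.
have [->|xy] /= := eqVneq x y; first by rewrite adj_irr.
(* If the address of [b] properly extends that of [a], the extension by its first letter is the
   address of some [z] in between; as [b] covers [a], it is the address of [b]. *)
have covE a b : cover_le s a b ->
    (support a == support b) || adj E (support a) (support b).
  case/cover_leP; rewrite sE => /prefixP[[|c w] e] H.
    by rewrite cats0 in e; rewrite (ad_inj _ _ e) eqxx.
  have pc : prefix (rcons (ad a) c) (ad b) by rewrite e -cat_rcons prefix_prefix.
  have [z ez] := closed _ _ pc.
  have [] := H z; rewrite ?sE ?ez ?prefix_rcons //.
    by move/size_prefix; rewrite size_rcons ltnn.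
  move=> /(prefix_anti pc) eb; apply/orP; right.
  exact: (root_path_adj PP (esym eb)).
have stepE a b : ad b = rcons (ad a) (support b) -> cover_le s a b.
  move=> e; apply/cover_leP; rewrite sE e prefix_rcons; split=> // z.
  rewrite !sE => az; rewrite e prefix_rconsE => /orP[/eqP ez|]; last by left.
  by right; rewrite ez prefix_refl.
rewrite adj_support //; apply/orP/orP => [[/covE/orP//|/covE]|[/eqP e|]].
- by rewrite adj_sym eq_sym => /orP.
- by left; apply: equ_cover => //; rewrite !sE /ad e prefix_refl.
by move/(root_path_step ET PP) => -[] e; [left|right]; apply: stepE.
Qed.

End LeafPower.

(** * Cardinalities of the constructions *)

Lemma card_Tagged (I : finType) (T_ : I -> finType) :
  #|{: {i : I & T_ i}}| = \sum_i #|T_ i|.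
Proof. by rewrite card_tagged sumnE big_map big_enum. Qed.

Lemma card_uprod A B n : #|uprod A B n| = \sum_(k < n.+1) #|A k| * #|B (n - k)|.
Proof. by rewrite card_Tagged; apply: eq_bigr => k _; rewrite card_prod. Qed.

Lemma card_lprod A B n :
  #|lprod A B n| = \sum_(S : {set 'I_n}) #|A #|S| | * #|B #|~: S| |.
Proof. by rewrite card_Tagged; apply: eq_bigr => k _; rewrite card_prod. Qed.

Lemma card_lsetge k A n : #|lsetge k A n| =
  \sum_(P : {set {set 'I_n}} | partition P setT && (k <= #|P|)) \prod_(B in P) #|A #|B| |.
Proof.
rewrite card_Tagged (big_sub [pred P : {set {set 'I_n}} | partition P setT && (k <= #|P|)]).
apply: eq_bigr => P _; rewrite card_dep_ffun foldrE big_map big_enum /=.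
by rewrite (big_sub (mem (val P)) (fun B => #|A #|B| |)).
Qed.

Lemma card_csum A B n : #|csum A B n| = #|A n| + #|B n|.
Proof. exact: card_sum. Qed.

Lemma card_atom n : #|atom n| = (n == 1).
Proof. exact: card_ord. Qed.

Lemma eq_lsetge k (A A' : cclass) n : (forall i, i <= n -> #|A i| = #|A' i|) ->
  #|lsetge k A n| = #|lsetge k A' n|.
Proof.
move=> AA'; rewrite !card_lsetge; apply: eq_bigr => P _; apply: eq_bigr => B _.
by apply: AA'; rewrite -[X in _ <= X]card_ord max_card.
Qed.

Lemma Tagged_injective (I : eqType) (T_ : I -> eqType) i :
  injective (fun a : T_ i => Tagged (fun i => T_ i) a).
Proof. by move=> a b /eqP; rewrite -tag_eqE /tag_eq eqxx tagged_asE => /eqP. Qed.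

Lemma card_tag_fiber (I : finType) (T_ : I -> finType) i :
  #|[set x : {i : I & T_ i} | tag x == i]| = #|T_ i|.
Proof.
rewrite -cardsT -(card_imset _ (@Tagged_injective _ T_ i)).
apply: eq_card => -[j b]; rewrite inE /=; apply/eqP/imsetP => [e|[a _ e]].
  by subst j; exists b.
exact: (congr1 (@tag _ _) e).
Qed.

(** Multiplicities are carried along a size-preserving bijection between the objects of [A] and of
    [A']. *)
Lemma eq_usetge k (A A' : cclass) n : (forall i, i <= n -> #|A i| = #|A' i|) ->
  #|usetge k A n| = #|usetge k A' n|.
Proof.
move=> AA'.
have [|f fB fE] := @fiber_bijection {i : 'I_n.+1 & A i} {i : 'I_n.+1 & A' i} _
  (@tag _ _) (@tag _ _).
  by move=> i; rewrite !card_tag_fiber AA' // -ltnS.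
have [g fK gK] := fB.
pose T (C : cclass) := {ffun {i : 'I_n.+1 & C i} -> 'I_n.+1}.
rewrite !card_sig -!sum1_card.
pose pu (m : T A') : T A := [ffun x => m (f x)].
pose qu (m : T A) : T A' := [ffun y => m (g y)].
rewrite (reindex pu); last first.
  by exists qu => m _; apply/ffunP => x; rewrite !ffunE ?fK ?gK.
apply: eq_bigl => m; rewrite !inE; congr (_ && _).
  rewrite [in RHS](reindex f) /=; last by exists g => x _.
  by congr (_ == _); apply: eq_bigr => x _; rewrite ffunE fE.
rewrite [in RHS](reindex f) /=; last by exists g => x _.
by congr (_ <= _); apply: eq_bigr => x _; rewrite ffunE.
Qed.

(** The bounds are asymmetric on purpose: as the left factor has no object of size 0, the right
    factor matters only below [n]. This is what makes the equation for S_X a recursion. *)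
Lemma eq_uprod (A A' B B' : cclass) n : (forall i, i <= n -> #|A i| = #|A' i|) -> #|A 0| = 0 ->
  (forall i, i < n -> #|B i| = #|B' i|) -> #|uprod A B n| = #|uprod A' B' n|.
Proof.
move=> AA' A0 BB'; rewrite !card_uprod; apply: eq_bigr => -[[|k] kn] _ /=.
  by rewrite -AA' // A0.
by rewrite AA' // BB' //; lia.
Qed.

Lemma eq_lprod (A A' B B' : cclass) n : (forall i, i <= n -> #|A i| = #|A' i|) -> #|A 0| = 0 ->
  (forall i, i < n -> #|B i| = #|B' i|) -> #|lprod A B n| = #|lprod A' B' n|.
Proof.
move=> AA' A0 BB'; rewrite !card_lprod; apply: eq_bigr => S _.
have := cardsC S; rewrite card_ord; case: #|S| => [|k] e.
  by rewrite -AA' // A0.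
by rewrite AA' ?BB' //; lia.
Qed.

(** All that uniqueness of the solution requires of a setting, so that the labeled and the unlabeled
    case share one proof. *)
Definition local_setting (s : setting) : Prop :=
  (forall k (A A' : cclass) n, (forall i, i <= n -> #|A i| = #|A' i|) ->
     #|csetge s k A n| = #|csetge s k A' n|) /\
  (forall (A A' B B' : cclass) n, (forall i, i <= n -> #|A i| = #|A' i|) -> #|A 0| = 0 ->
     (forall i, i < n -> #|B i| = #|B' i|) -> #|cprod s A B n| = #|cprod s A' B' n|).

Lemma labeled_local : local_setting labeled.
Proof. by split; [exact: eq_lsetge | exact: eq_lprod]. Qed.

Lemma unlabeled_local : local_setting unlabeled.
Proof. by split; [exact: eq_usetge | exact: eq_uprod]. Qed.

(** Only the equation for S_X is recursive. Since L has no object of size 0, its size [n] depends on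
    S_X below [n], and strong induction applies; the other classes follow. *)
Lemma system_unique s X Y : local_setting s ->
  system s X -> no_size0 X -> system s Y -> no_size0 Y -> classes_iso X Y.
Proof.
move=> [locS locP] [LPX [SCX [SXX [LX [LdX KdX]]]]] [SC0 SX0 L0 Ld0 Kd0].
move=> [LPY [SCY [SXY [LY [LdY KdY]]]]] _.
have eL n : #|L X n| = #|L Y n| by rewrite LX LY.
have eLd n : #|Ld X n| = #|Ld Y n| by rewrite LdX LdY.
have eKd n : #|Kd X n| = #|Kd Y n| by rewrite KdX KdY.
have eSX n : #|SX X n| = #|SX Y n|.
  have [m] := ubnP n; elim: m n => // m IH n nm.
  rewrite SXX SXY; apply: locP => // i lin; apply: locS => j ji.
  by rewrite !card_csum eL IH //; lia.
have eSC n : #|SC X n| = #|SC Y n|.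
  by rewrite SCX SCY; apply: locS => i _; rewrite !card_csum eL eSX.
do !split => // n; rewrite LPX LPY !card_csum eKd; congr (_ + _).
by apply: locP => // i _; rewrite !card_csum eSC eSX.
Qed.

(** * Labeled counts *)

Lemma enum_val_image (V : finType) (B : {set V}) :
  [set enum_val i | i in [set: 'I_#|B|]] = B.
Proof.
apply/setP => x; apply/imsetP/idP => [[i _ ->]|xB]; first exact: enum_valP.
by exists (enum_rank_in xB x); rewrite ?enum_rankK_in ?inE.
Qed.

Definition lcount g n := #|[set s : {set 'I_n * 'I_n} | kind g setT s]|.

Lemma card_kind_image g (W V : finType) (f : W -> V) : injective f ->
  #|[set s : {set V * V} | kind g (f @: setT) s]| =
  #|[set t : {set W * W} | kind g setT t]|.
Proof.
move=> fI; rewrite -[RHS](card_imset _ (push_inj fI)); apply: eq_card => s.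
rewrite inE; apply/idP/imsetP => [sB|[t]]; last by rewrite inE => tT ->; rewrite kind_push.
have e := push_pull fI (forest_sub (proj1 (andP sB))).
by exists [set p | (f p.1, f p.2) \in s]; rewrite // inE -(kind_push fI) e.
Qed.

Lemma card_kind g (V : finType) (B : {set V}) :
  #|[set s : {set V * V} | kind g B s]| = lcount g #|B|.
Proof.
by rewrite /lcount -(card_kind_image _ (@enum_val_inj _ (mem B))) enum_val_image.
Qed.

(** Restriction to the blocks and [join] are mutually inverse between these forests and the families
    of trees on the blocks of [P]. *)
Lemma card_forests_components n (P : {set {set 'I_n}}) : partition P setT ->
  #|[set s : {set 'I_n * 'I_n} | forest setT s && (components s setT == P)]| =
  \prod_(B in P) lcount tree_kind #|B|.
Proof.
move=> PT; pose F (B : {set 'I_n}) := [pred s | kind tree_kind B s].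
have -> : \prod_(B in P) lcount tree_kind #|B| = #|pfamily set0 (mem P) F|.
  rewrite card_pfamily foldrE big_map big_enum /=; apply: eq_bigr => B _.
  by rewrite -card_kind cardsE.
(* The value [set0] off [P] gives the functions of bounded support that [card_pfamily] counts. *)
pose split (s : {set 'I_n * 'I_n}) := [ffun B => if B \in P then restrict B s else set0].
have splitE s B : B \in P -> split s B = restrict B s by move=> BP; rewrite ffunE BP.
rewrite -(@card_in_imset _ _ split).
  apply: eq_card => u; apply/imsetP/pfamilyP => [[s]|[sup uF]].
    rewrite inE => /andP[sF /eqP sP] ->; split.
      apply/supportP => B; rewrite ffunE; exact: ifN.
    by move=> B BP; rewrite splitE // inE; apply: (components_tree sF); rewrite sP.
  have uP B : B \in P -> kind tree_kind B (u B) by move/uF.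
  exists (join P u); first by rewrite inE (join_forest PT uP) (join_components PT uP) eqxx.
  apply/ffunP => B; rewrite ffunE; case: ifPn => BP; first by rewrite (restrict_join PT uP).
  by apply/eqP; apply: contraNT BP; apply: (subsetP sup).
move=> s t; rewrite !inE => /andP[sF /eqP sP] /andP[tF /eqP tP] e.
rewrite (bigcup_components sF) (bigcup_components tF) sP tP; apply: eq_bigr => B BP.
by rewrite -!splitE // e.
Qed.

Lemma card_forests_lsetge k (A : cclass) n :
  (forall i, #|A i| = lcount tree_kind i) ->
  #|lsetge k A n| = #|[set s : {set 'I_n * 'I_n} | forest setT s && (k <= #|components s setT|)]|.
Proof.
move=> AE; rewrite card_lsetge -sum1dep_card.
rewrite (partition_big (fun s => components s setT)
  (fun P => partition P setT && (k <= #|P|))) /=; last first.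
  by move=> s /andP[sF ->]; rewrite components_partition.
apply: eq_bigr => P /andP[PT kP]; rewrite (eq_bigr _ (fun B _ => AE _)).
rewrite -card_forests_components // -sum1dep_card; apply: eq_bigl => s.
by rewrite -andbA; congr (_ && _); case: eqP => [->|]; rewrite ?kP ?andbF.
Qed.

Lemma lcount_forest1 (A : cclass) n : (forall i, #|A i| = lcount tree_kind i) ->
  #|lsetge 1 A n| = lcount forest1_kind n.
Proof.
move/card_forests_lsetge->; apply: eq_card => s; rewrite !inE /kind.
by case: (boolP (forest _ s)) => // sF; rewrite card_components_gt0.
Qed.

Lemma lcount_forest2 (A : cclass) n : (forall i, #|A i| = lcount tree_kind i) ->
  #|lsetge 2 A n| = lcount forest2_kind n.
Proof.
move/card_forests_lsetge->; apply: eq_card => s; rewrite !inE /kind.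
by case: (boolP (forest _ s)) => // sF; rewrite card_components_gt1.
Qed.

Lemma total_forest (V : finType) (B : {set V}) : forest B (setX B B).
Proof.
apply/forestP; split=> [x y|x xB|x y z|x y z]; rewrite !inE /=.
- by move/andP.
- by rewrite xB.
- by move=> /andP[-> _] /andP[].
by move=> /andP[-> _] /andP[-> _]; left.
Qed.

Lemma total_forest_eq (V : finType) (B : {set V}) s :
  forest B s -> total_on B s -> s = setX B B.
Proof.
move=> /forest_sub sB /total_onP H; apply/eqP; rewrite eqEsubset sB.
by apply/subsetP => -[x y]; rewrite inE => /andP[]; apply: H.
Qed.

Lemma total_has_min (V : finType) (B : {set V}) s :
  B != set0 -> total_on B s -> has_min B s.
Proof. by case/set0Pn => x xB /total_onP H; apply/has_minP; exists x => // y; apply: H. Qed.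

Lemma has_min_neq0 (V : finType) (B : {set V}) s : has_min B s -> B != set0.
Proof. by case/has_minP => x xB _; apply/set0Pn; exists x. Qed.

Lemma total_set0 (V : finType) (s : {set V * V}) : total_on set0 s.
Proof. by apply/total_onP => x y; rewrite inE. Qed.

(** The decomposition of trees as L + S_X: the total relation is the one tree that is a single
    block, matching the single object of L in each positive size. *)
Lemma tree_kindE (V : finType) (B : {set V}) s : kind tree_kind B s =
  kind thick_tree_kind B s || ((s == setX B B) && (B != set0)).
Proof.
apply/idP/orP => [/andP[sF /= m]|[/andP[sF /andP[m _]]|/andP[/eqP-> B0]]].
- have [t|t] := boolP (total_on B s); [right|left].
    by rewrite (total_forest_eq sF t) eqxx (has_min_neq0 m).
  by rewrite /kind sF /thick_tree_kind t andbT.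
- by rewrite /kind sF.
rewrite /kind total_forest; apply: total_has_min => //.
by apply/total_onP => x y xB yB; rewrite inE xB.
Qed.

Lemma thick_tree_not_total (V : finType) (B : {set V}) :
  kind thick_tree_kind B (setX B B) = false.
Proof.
apply/negP => /andP[_ /andP[_ /negP[]]].
by apply/total_onP => x y xB yB; rewrite inE xB.
Qed.

(** The sum S_C + S_X: a nonempty total relation has a minimum, so a nonempty forest without one is
    not total. *)
Lemma spread_kindE (V : finType) (B : {set V}) s : kind spread_kind B s =
  kind forest2_kind B s || kind thick_tree_kind B s.
Proof.
rewrite /kind -andb_orr; congr (_ && _).
rewrite /spread_kind /forest2_kind /thick_tree_kind.
have [->|B0] /= := eqVneq B set0; first by rewrite total_set0 andbF.
case m: (has_min B s) => //=.
by apply/negP => /(total_has_min B0); rewrite m.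
Qed.

Lemma forest2_thick_tree (V : finType) (B : {set V}) s :
  kind forest2_kind B s && kind thick_tree_kind B s = false.
Proof. by rewrite /kind /forest2_kind /thick_tree_kind; case: has_min; rewrite !andbF. Qed.

(** [A] is the set of all relations in the labeled setting and the set [reps] in the unlabeled one;
    the same holds for [card_tree]. *)
Lemma card_spread (n : nat) (A : {set {set 'I_n * 'I_n}}) :
  #|[set s in A | kind spread_kind setT s]| =
  #|[set s in A | kind forest2_kind setT s]| + #|[set s in A | kind thick_tree_kind setT s]|.
Proof.
rewrite -cardsUI (_ : _ :&: _ = set0) ?cards0 ?addn0.
  by apply: eq_card => s; rewrite !inE spread_kindE andb_orr.
by apply/setP => s; rewrite !inE andbACA andbb forest2_thick_tree andbF.
Qed.

Lemma card_tree (n : nat) (A : {set {set 'I_n * 'I_n}}) : setX setT setT \in A ->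
  #|[set s in A | kind tree_kind setT s]| =
  #|[set s in A | kind thick_tree_kind setT s]| + (0 < n).
Proof.
move=> TA; have <- : #|[set s in A | (s == setX setT setT) && ([set: 'I_n] != set0)]| = (0 < n).
  rewrite -cards_eq0 cardsT card_ord -lt0n; case: (0 < n).
    rewrite -[RHS]/1 -(cards1 (setX [set: 'I_n] [set: 'I_n])); apply: eq_card => s.
    by rewrite !inE andbT; case: eqP => [->|]; rewrite ?TA ?andbF.
  by apply/eqP; rewrite cards_eq0; apply/eqP/setP => s; rewrite !inE !andbF.
rewrite -cardsUI (_ : _ :&: _ = set0) ?cards0 ?addn0.
  by apply: eq_card => s; rewrite !inE tree_kindE andb_orr.
apply/setP => s; rewrite !inE andbACA andbb andbA; apply/negP => /andP[/andP[_ +]].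
by move=> + /andP[/eqP e _]; rewrite e thick_tree_not_total.
Qed.

Lemma set_inT (T : finType) (P : pred T) : [set s in setT | P s] = [set s | P s].
Proof. by apply/setP => s; rewrite !inE. Qed.

Lemma lcount_spread n :
  lcount spread_kind n = lcount forest2_kind n + lcount thick_tree_kind n.
Proof. by have := card_spread [set: {set 'I_n * 'I_n}]; rewrite !set_inT. Qed.

Lemma lcount_tree n : lcount tree_kind n = lcount thick_tree_kind n + (0 < n).
Proof. by have := card_tree (in_setT (setX [set: 'I_n] setT)); rewrite !set_inT. Qed.

(** A tree is total exactly when nothing hangs below its root block, so thick trees are a nonempty
    block with a nonempty forest below it: S_X = L x Set_{>=1}(L + S_X). *)
Lemma kind_hang (V : finType) (s : {set V * V}) :
  kind thick_tree_kind setT s =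
  [&& forest setT s, root_block s != set0 &
      kind forest1_kind (~: root_block s) (restrict (~: root_block s) s)].
Proof.
rewrite /kind; case: (boolP (forest setT s)) => //= sF.
rewrite /thick_tree_kind /forest1_kind -root_block_neq0.
have [//|A0] /= := eqVneq (root_block s) set0.
have cF := forest_restrict sF (subsetT (~: root_block s)); rewrite cF /=.
by congr (~~ _); rewrite -[in LHS](hang_root sF) total_hang.
Qed.

Lemma card_hang (V : finType) (A : {set V}) g : A != set0 ->
  #|[set s : {set V * V} | [&& forest setT s, root_block s == A & kind g (~: A) (restrict (~: A) s)]]| =
  lcount g #|~: A|.
Proof.
move=> A0; rewrite -card_kind -[RHS](@card_in_imset _ _ (hang A)); last first.
  move=> s t; rewrite !inE => /andP[sF _] /andP[tF _] e.
  by rewrite -(restrict_hang sF) -(restrict_hang tF) e.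
apply: eq_card => s; rewrite !inE; apply/and3P/imsetP => [[sF /eqP sA sk]|[t]].
  by exists (restrict (~: A) s); rewrite ?inE // -sA hang_root.
rewrite inE => tk ->; have /andP[tF _] := tk.
by rewrite hang_forest // root_block_hang // restrict_hang.
Qed.

Lemma lcount_thick_tree n : lcount thick_tree_kind n =
  \sum_(A : {set 'I_n}) (0 < #|A|) * lcount forest1_kind #|~: A|.
Proof.
rewrite {1}/lcount -sum1dep_card (partition_big (@root_block _) predT) //=.
apply: eq_bigr => A _; rewrite card_gt0.
have [->|A0] := eqVneq A set0.
  rewrite big1 // => s; rewrite kind_hang => /andP[/and3P[_ s0 _] /eqP e].
  by rewrite e eqxx in s0.
rewrite mul1n -(card_hang forest1_kind A0) sum1dep_card; apply: eq_card => s; rewrite !inE kind_hang.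
case: (boolP (forest setT s)) => //= sF; rewrite andbC.
by have [->|//] := eqVneq (root_block s) A; rewrite A0.
Qed.

(** The root ranges over the whole root block, which gives the marked atom of [Ld] its [#|A|]
    choices for a root block [A]. *)
Definition rooted_spread n : {set 'I_n * {set 'I_n * 'I_n}} :=
  [set p | [&& forest setT p.2, p.1 \in root_block p.2 & spread p.2]].

Lemma card_rooted_spread n : #|rooted_spread n| =
  \sum_(A : {set 'I_n}) #|A| * lcount spread_kind #|~: A|.
Proof.
rewrite -sum1_card (partition_big (fun p => root_block p.2) predT) //=.
apply: eq_bigr => A _.
have [->|A0] := eqVneq A set0.
  rewrite cards0 big1 // => -[r s]; rewrite inE /= => /andP[/and3P[_ restrict _] /eqP e].
  by rewrite e inE in restrict.
rewrite -(card_hang spread_kind A0) -cardsX -sum1_card; apply: eq_bigl => -[r s]; rewrite !inE /=.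
rewrite /spread /kind.
have [e|ne] := eqVneq (root_block s) A; last by rewrite !andbF.
rewrite -e inE !andbT.
case: (boolP (forest setT s)) => //= sF; last by rewrite andbF.
rewrite (forest_restrict sF (subsetT _)) /spread_kind /=; congr (_ && ~~ _).
apply/total_onP/total_onP => H x y xB yB; first by rewrite in_restrict xB yB H.
by have := H x y xB yB; rewrite in_restrict => /and3P[].
Qed.

(** * Isomorphism types *)

(** A type lives on all of [W], whereas a component or the part below the root block is only a
    subset [B] of [V]; the isomorphism therefore goes from [W] onto [B]. *)
Definition has_type (W V : finType) (t : {set W * W}) (B : {set V})
    (s : {set V * V}) : Prop :=
  exists f : W -> V, [/\ injective f, f @: setT = B & restrict B s = push f t].

Section HasType.
Variables (U W V : finType).
Implicit Types (u : {set U * U}) (t : {set W * W}) (s : {set V * V}) (B : {set V}).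

Lemma has_type_trans u t B s :
  has_type u setT t -> has_type t B s -> has_type u B s.
Proof.
move=> [g [gI gT]]; rewrite restrictT => tE [f [fI fB sE]]; exists (f \o g); split.
- exact: inj_comp.
- by rewrite imset_comp gT.
by rewrite sE tE push_comp.
Qed.

Lemma has_type_factor u t B s :
  has_type u B s -> has_type t B s -> has_type u setT t.
Proof.
move=> [g [gI gB sE]] [f [fI fB]]; rewrite sE => e.
have /choice[h hE] : forall a, exists b, f b = g a.
  by move=> a; have /imsetP[b _ ->] : g a \in f @: setT; [rewrite fB -gB imset_f|exists b].
have gh : g =1 f \o h by move=> a; rewrite /= hE.
exists h; split.
- by move=> a a' haa; apply: gI; rewrite !gh /= haa.
- apply/setP => b; rewrite inE; apply/imsetP.
  have /imsetP[a _ ba] : f b \in g @: setT by rewrite gB -fB imset_f.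
  by exists a => //; apply: fI; rewrite ba hE.
by rewrite restrictT; apply: (push_inj fI); rewrite -e push_comp; apply: eq_push.
Qed.

Lemma has_type_kind g t B s : has_type t B s -> kind g B (restrict B s) = kind g setT t.
Proof. by move=> [f [fI <- ->]]; rewrite kind_push. Qed.

Lemma has_type_card t B s : has_type t B s -> #|B| = #|W|.
Proof. by move=> [f [fI <- _]]; rewrite card_imset // cardsT. Qed.

Lemma has_type_refl s : has_type s setT s.
Proof. by exists id; split=> //; rewrite ?imset_id // restrictT push_id. Qed.

End HasType.

Lemma has_type_sym (W V : finType) (t : {set W * W}) (s : {set V * V}) :
  has_type t setT s -> has_type s setT t.
Proof. by move=> h; apply: has_type_factor h; apply: has_type_refl. Qed.

Lemma has_type_exists (V : finType) (B : {set V}) (s : {set V * V}) m : #|B| = m ->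
  exists t : {set 'I_m * 'I_m}, has_type t B s.
Proof.
move=> <-; pose f := @enum_val V (mem B).
have fI : injective f by apply: enum_val_inj.
have fB : f @: setT = B by apply: enum_val_image.
exists [set p | (f p.1, f p.2) \in s], f; split=> //.
apply/setP => -[x y]; rewrite in_restrict; apply/and3P/idP.
  move=> [xy xB yB]; have /imsetP[a _ xa] : x \in f @: setT by rewrite fB.
  have /imsetP[b _ yb] : y \in f @: setT by rewrite fB.
  by rewrite xa yb in_push // inE /= -xa -yb.
case/push_in => a [b [-> ->]]; rewrite inE /= => ab.
by split=> //; rewrite enum_valP.
Qed.

Section Reps.
Variable m : nat.
Implicit Types t u : {set 'I_m * 'I_m}.

(* [pick] depends only on the extension of its predicate, so isomorphic
   relations select the same representative. *)
Definition reps : {set {set 'I_m * 'I_m}} :=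
  [set t | [pick u | `[< has_type u setT t >]] == Some t].

Lemma rep_exists t : exists2 u, u \in reps & has_type u setT t.
Proof.
case E : [pick u | `[< has_type u setT t >]] => [u|]; last first.
  move: E; case: pickP => // /(_ t) /negbT /negP[]; apply/asboolP.
  exact: has_type_refl.
have ut : has_type u setT t by move: E; case: pickP => // v /asboolP h [<-].
exists u => //; rewrite inE -E; apply/eqP; apply: eq_pick => v.
apply/asboolP/asboolP => h; first exact: has_type_trans ut.
exact: has_type_factor ut.
Qed.

Lemma rep_uniq t u : t \in reps -> u \in reps -> has_type u setT t -> t = u.
Proof.
rewrite !inE => /eqP tE /eqP uE ut; apply: Some_inj; rewrite -tE -uE.
apply: eq_pick => v; apply/asboolP/asboolP => h; last exact: has_type_trans ut.
exact: has_type_factor ut.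
Qed.

Lemma type_exists (V : finType) (B : {set V}) (s : {set V * V}) : #|B| = m ->
  exists2 t, t \in reps & has_type t B s.
Proof.
move/(has_type_exists s) => [t tB]; have [u uR ut] := rep_exists t.
by exists u => //; apply: has_type_trans tB.
Qed.

Lemma type_uniq (V : finType) (B : {set V}) (s : {set V * V}) t u :
  t \in reps -> u \in reps -> has_type t B s -> has_type u B s -> t = u.
Proof. by move=> tR uR tB uB; apply: rep_uniq => //; apply: has_type_factor tB. Qed.

(** Every relation isomorphic to the total one equals it, so its isomorphism class has no other
    candidate for a representative. *)
Lemma total_rep : setX setT setT \in reps.
Proof.
have [u uR [f [fI fT]]] := rep_exists (setX setT setT).
rewrite restrictT => e; suff -> : setX setT setT = u by [].
apply/setP => -[a b]; rewrite -(in_push fI) -(in_push fI u) -e.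
by rewrite in_push // !inE.
Qed.

End Reps.

Definition ucount g n := #|[set t in reps n | kind g setT t]|.

Lemma ucount_spread n :
  ucount spread_kind n = ucount forest2_kind n + ucount thick_tree_kind n.
Proof. exact: card_spread. Qed.

Lemma ucount_tree n : ucount tree_kind n = ucount thick_tree_kind n + (0 < n).
Proof. exact/card_tree/total_rep. Qed.

Section RootBlock.
Variables (n m : nat) (t : {set 'I_m * 'I_m}).
Notation below s := (~: root_block s).

Lemma has_type_root (s s' : {set 'I_n * 'I_n}) :
  has_type s setT s' -> has_type t (below s) s -> has_type t (below s') s'.
Proof.
move=> [g [gI gT]]; rewrite restrictT => -> [f [fI fB sE]].
have bE : below (push g s) = g @: below s.
  rewrite root_block_push //; apply/setP => x.
  have /imsetP[a _ ->] : x \in g @: setT by rewrite gT inE.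
  by rewrite in_setC !mem_imset // in_setC.
exists (g \o f); split; first exact: inj_comp.
  by rewrite imset_comp fB bE.
by rewrite bE restrict_push // sE push_comp.
Qed.

Lemma hang_exists : forest setT t -> m < n ->
  exists2 s : {set 'I_n * 'I_n}, forest setT s /\ has_min setT s &
    has_type t (below s) s.
Proof.
move=> tF mn; pose f := widen_ord (ltnW mn).
have fI : injective f by move=> a b /(congr1 val) /= /val_inj.
(* [t] sits on the first [m] points; the other [n - m] points form the root block, nonempty because
   [m < n]. *)
pose A := ~: (f @: setT); pose s := hang A (push f t).
have pF : forest (~: A) (push f t) by rewrite setCK forest_push.
have A0 : A != set0.
  by rewrite -card_gt0 cardsCs setCK card_imset // cardsT !card_ord subn_gt0.
have rE : root_block s = A by apply: root_block_hang.
exists s; first by split; [exact: hang_forest|exact: hang_min].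
by exists f; split; rewrite // rE ?restrict_hang // setCK.
Qed.

(** The type of the part below the root block determines the rooted preorder: match the two lower
    parts, send [r] to [r'], and extend to the rest of the root blocks in any way. The option type
    adds the root to the domain of the matching. *)
Lemma rooted_iso_exists (s s' : {set 'I_n * 'I_n}) r r' :
  forest setT s -> forest setT s' -> r \in root_block s -> r' \in root_block s' ->
  has_type t (below s) s -> has_type t (below s') s' ->
  exists2 g : 'I_n -> 'I_n, injective g & g r = r' /\ push g s = s'.
Proof.
move=> sF s'F rs_ rs' [f [fI fB sE]] [f' [f'I f'B s'E]].
pose ext (r : 'I_n) (f : 'I_m -> 'I_n) o := if o is Some a then f a else r.
have extI r0 (f0 : 'I_m -> 'I_n) (s0 : {set 'I_n * 'I_n}) : injective f0 -> r0 \in root_block s0 ->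
    f0 @: setT = below s0 -> injective (ext r0 f0).
  move=> f0I r0s f0B; have f0r a : f0 a != r0.
    by apply: contraTneq (imset_f f0 (in_setT a)) => ->; rewrite f0B inE r0s.
  move=> [a|] [b|] //= e; first by rewrite (f0I _ _ e).
    by have := f0r a; rewrite e eqxx.
  by have := f0r b; rewrite e eqxx.
have [g gI gE] := extend_injection (extI _ _ _ fI rs_ fB) (extI _ _ _ f'I rs' f'B).
have gf a : g (f a) = f' a by apply: (gE (Some a)).
have gC (A : {set 'I_n}) : g @: (~: A) = ~: (g @: A).
  apply/setP => x; rewrite -(f_invF gI x) mem_imset // !inE.
  by rewrite mem_imset.
exists g => //; split; first exact: (gE None).
rewrite -(hang_root sF) -(hang_root s'F) push_hang //; congr hang.
  apply: setC_inj; rewrite -gC -fB -f'B -imset_comp; exact: eq_imset.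
by rewrite sE s'E push_comp; apply: eq_push.
Qed.

End RootBlock.

Lemma card_root_block (n m : nat) (t : {set 'I_m * 'I_m}) (s : {set 'I_n * 'I_n}) :
  has_type t (~: root_block s) s -> #|root_block s| = n - m.
Proof. by move=> /has_type_card e; rewrite cardsCs e !card_ord. Qed.

Lemma kind_hang_type (n m : nat) (t : {set 'I_m * 'I_m}) (s : {set 'I_n * 'I_n}) :
  forest setT s -> has_min setT s -> has_type t (~: root_block s) s ->
  kind thick_tree_kind setT s = kind forest1_kind setT t.
Proof.
by move=> sF sm st; rewrite kind_hang sF root_block_neq0 sm -(has_type_kind _ st).
Qed.

(** Up to isomorphism only the size [k] of the root block matters; for fixed [k > 0] a thick tree is
    matched with the type of what lies below its root block. *)
Lemma ucount_thick_tree n : ucount thick_tree_kind n =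
  \sum_(k < n.+1) (0 < k) * ucount forest1_kind (n - k).
Proof.
rewrite {1}/ucount -sum1dep_card.
have bound (s : {set 'I_n * 'I_n}) : #|root_block s| < n.+1.
  by rewrite ltnS -[X in _ <= X]card_ord max_card.
rewrite (partition_big (fun s => Ordinal (bound s)) predT) //=.
apply: eq_bigr => -[k kn] _ /=; rewrite sum1dep_card.
have thickP s : kind thick_tree_kind setT s -> forest setT s /\ has_min setT s.
  by case/andP => sF /andP[].
(* A thick tree has a minimum, so no root block has size 0. *)
case: k kn => [|k] kn.
  apply/eqP; rewrite mul0n cards_eq0; apply/eqP/setP => s; rewrite !inE.
  apply/negP => /andP[/andP[_ /thickP[_ sm]] /eqP[/eqP]].
  by rewrite cards_eq0 -[_ == _]negbK root_block_neq0 sm.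
rewrite mul1n.
apply: (@card_rel _ _ _ _ (fun s t => has_type t (~: root_block s) s)).
- move=> s; rewrite inE => /andP[/andP[sR sk] /eqP[sc]].
  have [sF sm] := thickP _ _ sk.
  have [|t tR ts] := @type_exists (n - k.+1) _ (~: root_block s) s.
    by rewrite cardsCs setCK card_ord sc.
  by exists t; rewrite // inE tR -(kind_hang_type sF sm ts).
- move=> t; rewrite inE => /andP[tR tk]; have tF := proj1 (andP tk).
  have [|s0 [s0F s0m] s0t] := @hang_exists n _ _ tF; first by rewrite -ltnS; lia.
  have [s sR ss0] := rep_exists s0.
  have st := has_type_root (has_type_sym ss0) s0t.
  have kE g : kind g setT s = kind g setT s0.
    by rewrite -(has_type_kind g ss0) restrictT.
  have sk : kind thick_tree_kind setT s by rewrite kE (kind_hang_type s0F s0m s0t).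
  exists s => //; rewrite inE sR sk /= -val_eqE /= (card_root_block st).
  by apply/eqP; lia.
- move=> s s' t; rewrite inE => /andP[/andP[sR sk] _].
  rewrite inE => /andP[/andP[s'R s'k] _] _ st s't.
  have [sF] := thickP _ _ sk; rewrite -root_block_neq0 => /set0Pn[r rs_].
  have [s'F] := thickP _ _ s'k; rewrite -root_block_neq0 => /set0Pn[r' rs'].
  have [g gI [_ gs]] := rooted_iso_exists sF s'F rs_ rs' st s't.
  apply: esym; apply: (rep_uniq s'R sR); exists g; split=> //; last by rewrite restrictT.
  by apply/setP => x; rewrite inE -(f_invF gI x) imset_f.
move=> s t t' _; rewrite inE => /andP[tR _]; rewrite inE => /andP[t'R _] st st'.
exact: type_uniq st st'.
Qed.

(** * Multisets of trees *)

(** A concrete model of L + S_X whose objects are relations; [eq_usetge] transfers the count of its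
    multisets to every equinumerous class. *)
Definition tree_type : cclass :=
  fun i => {t : {set 'I_i * 'I_i} | (t \in reps i) && kind tree_kind setT t}.

Lemma card_tree_type i : #|tree_type i| = ucount tree_kind i.
Proof. by rewrite card_sig /ucount cardsE. Qed.

Section Multiset.
Variable n : nat.
Notation X := {i : 'I_n.+1 & tree_type i}.

Definition shape (x : X) : {set 'I_(tag x) * 'I_(tag x)} := val (tagged x).

Lemma shape_rep x : shape x \in reps (tag x).
Proof. by rewrite /shape; case: (tagged x) => t /= /andP[]. Qed.

Lemma shape_tree x : kind tree_kind setT (shape x).
Proof. by rewrite /shape; case: (tagged x) => t /= /andP[]. Qed.

Definition typed (V : finType) (s : {set V * V}) (x : X) : {set {set V}} :=
  [set C in components s setT | `[< has_type (shape x) C s >]].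

Lemma typed_in (V : finType) (s : {set V * V}) x C :
  C \in typed s x -> C \in components s setT /\ has_type (shape x) C s.
Proof. by rewrite inE => /andP[-> /asboolP]. Qed.

Lemma shape_uniq (V : finType) (s : {set V * V}) C x y :
  has_type (shape x) C s -> has_type (shape y) C s -> x = y.
Proof.
move=> hx hy; have := has_type_card hx; rewrite (has_type_card hy) !card_ord.
move=> /val_inj; move: hx hy (shape_rep x) (shape_rep y).
case: x => i [t tp]; case: y => j [u up]; rewrite /shape /= => ht hu tR uR ij.
subst j; have tu := type_uniq tR uR ht hu; subst u.
by rewrite (bool_irrelevance tp up).
Qed.

Lemma shape_exists (V : finType) (s : {set V * V}) C : #|V| <= n ->
  forest setT s -> C \in components s setT -> exists x, has_type (shape x) C s.
Proof.
move=> Vn sF CP; have [t tR tC] := @type_exists #|C| _ C s erefl.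
have Cn : #|C| < n.+1 by rewrite ltnS (leq_trans (max_card _) Vn).
have tp : (t \in reps #|C|) && kind tree_kind setT t.
  by rewrite tR -(has_type_kind _ tC) (components_tree sF).
by exists (existT (fun i : 'I_n.+1 => tree_type i) (Ordinal Cn) (exist _ t tp)).
Qed.

(** Each component has exactly one type, so a sum over types weighted by multiplicity is a sum over
    components. The weights in use are the size and the constant 1. *)
Lemma sum_typed (V : finType) (s : {set V * V}) (w : X -> nat) (w' : {set V} -> nat) :
  #|V| <= n -> forest setT s ->
  (forall x C, has_type (shape x) C s -> w x = w' C) ->
  \sum_x #|typed s x| * w x = \sum_(C in components s setT) w' C.
Proof.
move=> Vn sF ww'.
transitivity (\sum_x \sum_(C in components s setT | `[< has_type (shape x) C s >]) w x).
  by apply: eq_bigr => x _; rewrite sum_nat_const /typed cardsE.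
rewrite (exchange_big_dep (fun C => C \in components s setT)) /=; last by move=> x C _ /andP[].
apply: eq_bigr => C CP; have [x hx] := shape_exists Vn sF CP.
rewrite (big_pred1 x) ?(ww' x C) // => y; rewrite CP /=.
by apply/asboolP/eqP => [hy|->//]; apply: shape_uniq hy hx.
Qed.

Lemma typed_push (W V : finType) (g : W -> V) (s : {set W * W}) x : injective g ->
  g @: setT = setT -> #|typed (push g s) x| = #|typed s x|.
Proof.
move=> gI gT; rewrite -(card_imset _ (imset_inj gI)); apply: eq_card => C.
have gs v : exists a, v = g a.
  by have /imsetP[a _ ->] : v \in g @: setT; [rewrite gT inE | exists a].
have compE a : component (push g s) (g a) = g @: component s a.
  apply/setP => v; have [b ->] := gs v; rewrite mem_imset //.
  apply/componentP/componentP => -[z za zb]; last by exists (g z); rewrite in_push.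
  by have [c ec] := gs z; exists c; rewrite -(in_push gI) -ec.
have htE (D : {set W}) : has_type (shape x) (g @: D) (push g s) <-> has_type (shape x) D s.
  split=> -[f [fI fD]]; last first.
    move=> e; exists (g \o f); split; first exact: inj_comp.
      by rewrite imset_comp fD.
    by rewrite restrict_push // e push_comp.
  move=> e; have /choice[h hE] : forall a, exists b, g b = f a.
    by move=> a; have [b ->] := gs (f a); exists b.
  have fh : f =1 g \o h by move=> a; rewrite /= hE.
  exists h; split.
  - by move=> a b hab; apply: fI; rewrite !fh /= hab.
  - by apply: (imset_inj gI); rewrite -fD -imset_comp; apply: eq_imset => a; rewrite fh.
  by apply: (push_inj gI); rewrite -restrict_push // e push_comp; apply: eq_push.
apply/idP/imsetP => [/typed_in[/imsetP[v _ ->]]|[D /typed_in[/imsetP[a _ ->]]]].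
  have [a ->] := gs v; rewrite compE => /htE h; exists (component s a) => //.
  by rewrite inE imset_f //; apply/asboolP.
move=> /htE h ->; have e := compE a.
have {}h : has_type (shape x) (component (push g s) (g a)) (push g s) by rewrite e.
by rewrite -e inE imset_f //=; apply/asboolP.
Qed.

(** * The forest with prescribed multiplicities *)

Section Model.
Variable m : {ffun X -> 'I_n.+1}.

(** A point of the disjoint union: a tree type, the number of one of its copies, and a position in
    that copy. *)
Definition mpoint : finType := {x : X & ('I_(m x) * 'I_(tag x))%type}.

Definition mp (x : X) (j : 'I_(m x)) (a : 'I_(tag x)) : mpoint :=
  existT (fun x : X => ('I_(m x) * 'I_(tag x))%type) x (j, a).

Definition copy (x : X) (j : 'I_(m x)) : {set mpoint} := mp j @: setT.

Definition model : {set mpoint * mpoint} :=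
  \bigcup_x \bigcup_(j : 'I_(m x)) push (mp j) (shape x).

Lemma modelP w w' : reflect
  (exists x (j : 'I_(m x)) a b, [/\ w = mp j a, w' = mp j b & (a, b) \in shape x])
  ((w, w') \in model).
Proof.
apply: (iffP bigcupP) => [[x _ /bigcupP[j _ /push_in[a [b [-> -> ab]]]]]|].
  by exists x, j, a, b.
case=> x [j [a [b [-> -> ab]]]]; exists x => //; apply/bigcupP; exists j => //.
by apply/imsetP; exists (a, b).
Qed.

Lemma mp_inj x (j j' : 'I_(m x)) a b : mp j a = mp j' b -> j = j' /\ a = b.
Proof.
by move/(@Tagged_injective _ (fun x : X => ('I_(m x) * 'I_(tag x))%type : finType) x) => -[].
Qed.

Lemma mp_injective x (j : 'I_(m x)) : injective (mp j).
Proof. by move=> a b /mp_inj[]. Qed.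

Lemma in_model x (j j' : 'I_(m x)) a b :
  ((mp j a, mp j' b) \in model) = (j == j') && ((a, b) \in shape x).
Proof.
apply/modelP/andP => [[y [k [c [d [e1 e2 cd]]]]]|[/eqP<- ab]]; last by exists x, j, a, b.
have xy := congr1 (@tag _ _) e1; rewrite /= in xy; subst y.
by have [-> ->] := mp_inj e1; have [-> ->] := mp_inj e2.
Qed.

(** Forests with equal multiplicities are isomorphic to one common forest, which makes the
    multiplicities a complete invariant. The isomorphism is assembled from a numbering of the
    components of each type and one isomorphism per component. *)
Lemma model_has_type (V : finType) (s : {set V * V}) : #|V| <= n -> forest setT s ->
  (forall x, m x = #|typed s x| :> nat) -> has_type model setT s.
Proof.
move=> Vn sF mE.
(* [cid] turns existence into data, so that the numberings can be chosen dependently on [x]. *)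
have c x : {c : 'I_(m x) -> {set V} | [/\ injective c, forall j, c j \in typed s x
    & forall C, C \in typed s x -> exists j, C = c j]}.
  apply: cid; exists (fun j => enum_val (cast_ord (mE x) j)); split.
  - by move=> j j' /enum_val_inj /cast_ord_inj.
  - by move=> j; apply: enum_valP.
  move=> C Cx; exists (cast_ord (esym (mE x)) (enum_rank_in Cx C)).
  by rewrite cast_ordKV enum_rankK_in.
have {c} [cell cellC] : exists cell : forall x : X, 'I_(m x) -> {set V}, forall x,
    [/\ injective (cell x), forall j, cell x j \in typed s x
      & forall C, C \in typed s x -> exists j, C = cell x j].
  by exists (fun x => sval (c x)) => x; exact: svalP (c x).
have cellP x j : cell x j \in components s setT /\ has_type (shape x) (cell x j) s.
  by apply: typed_in; case: (cellC x) => _ + _; apply.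
have F (x : X) (j : 'I_(m x)) : {f : 'I_(tag x) -> V |
    [/\ injective f, f @: setT = cell x j & restrict (cell x j) s = push f (shape x)]}.
  by apply: cid; case: (cellP x j).
have {F} [f fP] : exists f : forall x : X, 'I_(m x) -> 'I_(tag x) -> V, forall x j,
    [/\ injective (f x j), f x j @: setT = cell x j
      & restrict (cell x j) s = push (f x j) (shape x)].
  by exists (fun x j => sval (F x j)) => x j; exact: svalP (F x j).
pose h (w : mpoint) := let: existT x ja := w in f x ja.1 ja.2.
have hin (x : X) (j : 'I_(m x)) (a : 'I_(tag x)) : h (mp j a) \in cell x j.
  by case: (fP x j) => _ <- _; apply: imset_f.
(* Components sharing a point are equal, hence have the same type and, the numbering being
   injective, the same number. *)
have cell_inj (x : X) (j : 'I_(m x)) (x' : X) (j' : 'I_(m x')) v : v \in cell x j -> v \in cell x' j' ->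
    existT (fun x : X => 'I_(m x)) x j = existT (fun x : X => 'I_(m x)) x' j'.
  have [Cx hx] := cellP x j; have [Cx' hx'] := cellP x' j' => vx vx'.
  have e : cell x j = cell x' j' by rewrite (components_eq sF Cx vx) (components_eq sF Cx' vx').
  rewrite -e in hx'; have xx' := shape_uniq hx hx'; subst x'.
  by case: (cellC x) => cI _ _; rewrite (cI j j').
have hsurj v : exists x j a, v = h (@mp x j a).
  have CP : component s v \in components s setT by apply: imset_f.
  have [x hx] := shape_exists Vn sF CP.
  have Cx : component s v \in typed s x by rewrite inE CP; apply/asboolP.
  have [_ _ /(_ _ Cx)[j Cj]] := cellC x.
  have : v \in cell x j by rewrite -Cj (component_refl sF) ?inE.
  case: (fP x j) => _ <- _ /imsetP[a _ ->]; by exists x, j, a.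
have hI : injective h.
  move=> [x [j a]] [x' [j' a']] e; have vx := hin x j a; have vx' := hin x' j' a'.
  rewrite -[h (mp j' a')]/(h (existT _ x' (j', a'))) -e in vx'.
  have jj' := cell_inj _ _ _ _ _ vx vx'.
  have xx' := congr1 (@tag _ _) jj'; rewrite /= in xx'; subst x'.
  move/(@Tagged_injective _ (fun x : X => 'I_(m x) : finType) x): jj' => jj'; subst j'.
  by case: (fP x j) => fI _ _; rewrite (fI a a').
have hT : h @: setT = setT.
  apply/setP => v; rewrite inE; have [x [j [a ->]]] := hsurj v; exact: imset_f.
exists h; split=> //; rewrite restrictT; apply/setP => -[v v'].
have [x [j [a ->]]] := hsurj v; have [x' [j' [a' ->]]] := hsurj v'.
have sE (b : 'I_(tag x)) : ((h (mp j a), h (mp j b)) \in s) = ((a, b) \in shape x).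
  case: (fP x j) => fI _ e; rewrite -(in_push fI) -e in_restrict.
  by rewrite -!/(h (mp j _)) !hin !andbT.
rewrite in_push //; apply/idP/idP => [aa'|].
  have e := le_component sF aa'.
  have [Cx _] := cellP x j; have [Cx' _] := cellP x' j'.
  rewrite -(components_eq sF Cx (hin _ _ _)) -(components_eq sF Cx' (hin _ _ _)) in e.
  have vx' := hin x' j' a'; rewrite -e in vx'.
  have jj' := cell_inj _ _ _ _ _ vx' (hin x' j' a').
  have xx' := congr1 (@tag _ _) jj'; rewrite /= in xx'; subst x'.
  move/(@Tagged_injective _ (fun x : X => 'I_(m x) : finType) x): jj' => jj'; subst j'.
  by rewrite in_model eqxx -sE.
case/modelP => y [k [b [b' [e1 e2 bb']]]].
have xy := congr1 (@tag _ _) e1; rewrite /= in xy; subst y.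
have xx' := congr1 (@tag _ _) e2; rewrite /= in xx'; subst x'.
have [jk ab] := mp_inj e1; have [j'k ab'] := mp_inj e2; subst k j' b b'.
by rewrite sE.
Qed.

Lemma restrict_copy x (j : 'I_(m x)) : restrict (copy j) model = push (mp j) (shape x).
Proof.
apply/setP => -[w w']; rewrite in_restrict; apply/and3P/idP.
  case=> + /imsetP[a _ ea] /imsetP[b _ eb]; rewrite {}ea {}eb.
  by rewrite in_model in_push ?eqxx //; apply: mp_injective.
case/push_in => a [b [-> -> ab]]; rewrite in_model eqxx ab; split=> //; exact: imset_f.
Qed.

Lemma copy_type x (j : 'I_(m x)) : has_type (shape x) (copy j) model.
Proof. by exists (mp j); split=> //; [exact: mp_injective | exact: restrict_copy]. Qed.

Definition copies : {set {set mpoint}} := [set copy (tagged xj) | xj : {x : X & 'I_(m x)}].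

Lemma in_copies C : reflect (exists x (j : 'I_(m x)), C = copy j) (C \in copies).
Proof.
apply: (iffP imsetP) => [[[x j] _ ->]|[x [j ->]]]; first by exists x, j.
by exists (existT _ x j).
Qed.

Lemma mp_in_copy x (j : 'I_(m x)) a x' (j' : 'I_(m x')) : mp j a \in copy j' ->
  copy j' = copy j.
Proof.
case/imsetP => b _ e; have xx' := congr1 (@tag _ _) e; rewrite /= in xx'; subst x'.
by have [->] := mp_inj e.
Qed.

Lemma copy_neq0 x (j : 'I_(m x)) : exists a, mp j a \in copy j.
Proof.
have /andP[_ /has_minP[a _ _]] := shape_tree x.
by exists a; apply: imset_f.
Qed.

Lemma copies_partition : partition copies setT.
Proof.
apply/and3P; split.
- apply/eqP/setP => -[x [j a]]; rewrite inE; apply/bigcupP; exists (copy j).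
    by apply/in_copies; exists x, j.
  exact: imset_f.
- apply/trivIsetP => _ _ /in_copies[x [j ->]] /in_copies[x' [j' ->]].
  apply: contraNT => /pred0Pn[[y [k a]] /andP[/= h1 h2]].
  by rewrite (mp_in_copy h1) (mp_in_copy h2).
apply/negP => /in_copies[x [j e]]; have [a] := copy_neq0 j.
by rewrite -e inE.
Qed.

Lemma copies_tree C : C \in copies -> kind tree_kind C (restrict C model).
Proof.
by case/in_copies => x [j ->]; rewrite (has_type_kind _ (copy_type j)) shape_tree.
Qed.

Lemma model_join : join copies (fun C => restrict C model) = model.
Proof.
apply/setP => -[w w']; apply/bigcupP/idP => [[C _]|ww'].
  by rewrite in_restrict => /and3P[].
case/modelP: (ww') => x [j [a [b [ew ew' _]]]]; exists (copy j).
  by apply/in_copies; exists x, j.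
by rewrite in_restrict ww' ew ew' !imset_f.
Qed.

Lemma model_forest : forest setT model.
Proof. by rewrite -model_join; apply: join_forest copies_partition copies_tree. Qed.

Lemma model_components : components model setT = copies.
Proof. by rewrite -{1}model_join; apply: join_components copies_partition copies_tree. Qed.

Lemma card_typed_model x : #|typed model x| = m x.
Proof.
have cI : injective (@copy x).
  move=> j j' e; have [a] := copy_neq0 j.
  by rewrite e => /imsetP[b _ /mp_inj[]].
rewrite -[RHS]card_ord -cardsT -(card_imset _ cI); apply: eq_card => C.
apply/idP/imsetP => [/typed_in[]|[j _ ->]].
  rewrite model_components => /in_copies[y [j ->]] hx.
  have xy := shape_uniq hx (copy_type j); subst y; by exists j.
rewrite inE model_components; apply/andP; split.
  by apply/in_copies; exists x, j.
by apply/asboolP/copy_type.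
Qed.

Lemma card_mpoint : #|mpoint| = \sum_x m x * tag x.
Proof.
by rewrite card_Tagged; apply: eq_bigr => x _; rewrite card_prod !card_ord.
Qed.

End Model.

(** A forest is matched with the multiplicities of the types of its components. [model] realizes
    every multiset, and [model_has_type] shows that the forest is determined up to isomorphism. *)
Lemma card_usetge_tree_type k : #|usetge k tree_type n| =
  #|[set s in reps n | forest setT s && (k <= #|components s setT|)]|.
Proof.
have -> : #|usetge k tree_type n| = #|[set m : {ffun X -> 'I_n.+1} |
    (\sum_x m x * tag x == n) && (k <= \sum_x m x)]| by rewrite card_sig cardsE.
apply/esym.
have n_le : #|'I_n| <= n by rewrite card_ord.
have total (s : {set 'I_n * 'I_n}) : forest setT s -> \sum_x #|typed s x| * tag x = n.
  move=> sF; rewrite (@sum_typed _ s (fun x => tag x) (fun C => #|C|)) //.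
    by rewrite -(card_partition (components_partition sF)) cardsT card_ord.
  by move=> x C /has_type_card ->; rewrite card_ord.
have number (s : {set 'I_n * 'I_n}) : forest setT s -> \sum_x #|typed s x| = #|components s setT|.
  move=> sF; have := @sum_typed _ s (fun=> 1) (fun=> 1) n_le sF (fun _ _ _ => erefl).
  by rewrite sum1_card => <-; apply: eq_bigr => x _; rewrite muln1.
apply: (@card_rel _ _ _ _ (fun (s : {set 'I_n * 'I_n}) (m : {ffun X -> 'I_n.+1}) =>
  forall x : X, m x = #|typed s x| :> nat)).
- move=> s; rewrite inE => /and3P[sR sF ks].
  (* [inord] loses nothing: a multiplicity is at most the number of components, which is at most
     [n]. *)
  have mE x : (inord #|typed s x| : 'I_n.+1) = #|typed s x| :> nat.
    rewrite inordK // ltnS.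
    apply: (@leq_trans #|components s setT|).
      by apply/subset_leq_card/subsetP => C /typed_in[].
    by rewrite -[X in _ <= X]card_ord -cardsT leq_imset_card.
  exists [ffun x => inord #|typed s x|] => [|x]; last by rewrite ffunE mE.
  rewrite !inE; apply/andP; split.
    by rewrite -[X in _ == X](total s sF); apply/eqP/eq_bigr => x _; rewrite ffunE mE.
  by rewrite (leq_trans ks) // -(number s sF) leq_eqVlt; apply/orP; left;
    apply/eqP/eq_bigr => x _; rewrite ffunE mE.
- move=> m; rewrite !inE => /andP[/eqP mn mk].
  have [|s sR sm] := @type_exists n _ setT (model m).
    by rewrite cardsT card_mpoint.
  have sF : forest setT s.
    have := has_type_kind (fun _ _ _ => true) sm.
    by rewrite restrictT /kind !andbT model_forest => <-.
  have mE x : m x = #|typed s x| :> nat.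
    case: sm => g [gI gT]; rewrite restrictT => e.
    by rewrite -(typed_push _ _ gI gT) -e card_typed_model.
  exists s => //; rewrite inE sR sF -(number s sF) (leq_trans mk) //.
  by rewrite leq_eqVlt; apply/orP; left; apply/eqP/eq_bigr => x _.
- move=> s s' m sA s'A _ sm s'm.
  move: sA; rewrite in_set => /and3P[sR sF _].
  move: s'A; rewrite in_set => /and3P[s'R s'F _].
  apply: (rep_uniq sR s'R).
  apply: has_type_trans (model_has_type n_le sF sm).
  exact: has_type_sym (model_has_type n_le s'F s'm).
move=> s m m' _ _ _ sm sm'; apply/ffunP => x; apply: val_inj.
by rewrite /= sm sm'.
Qed.

End Multiset.

(** * Counting rooted 3-leaf power graphs *)

(** [M] ties each element to a complete invariant of its class. It is a relation because the
    invariant is known only through a witness. *)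
Lemma card_classes (X Y : finType) (R : rel X) (D : {set X}) (B : {set Y})
    (M : X -> Y -> Prop) : equivalence_rel R ->
  (forall x, x \in D -> exists2 y, y \in B & M x y) ->
  (forall y, y \in B -> exists2 x, x \in D & M x y) ->
  (forall x x' y, M x y -> M x' y -> R x x') ->
  (forall x x' y y', R x x' -> M x y -> M x' y' -> y = y') ->
  #|equivalence_partition R D| = #|B|.
Proof.
move=> RE totX totY MR Muniq.
have RD : {in D & &, equivalence_rel R} by move=> x y z _ _ _; apply: RE.
have Pp := equivalence_partitionP RD; have /and3P[_ tP _] := Pp.
have sub C x : C \in equivalence_partition R D -> x \in C -> x \in D.
  by move=> CP xC; rewrite -(cover_partition Pp); apply/bigcupP; exists C.
have same C C' x x' : C \in equivalence_partition R D -> C' \in equivalence_partition R D ->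
    x \in C -> x' \in C' -> (C == C') = R x x'.
  move=> CP C'P xC x'C'; have [xD x'D] := (sub _ _ CP xC, sub _ _ C'P x'C').
  rewrite -(pblock_equivalence_partition RD xD x'D).
  rewrite (def_pblock tP CP xC); apply/eqP/idP => [->//|x'C].
  by rewrite -(def_pblock tP CP x'C) (def_pblock tP C'P x'C').
apply: (@card_rel _ _ _ _ (fun (C : {set X}) (y : Y) => exists2 x, x \in C & M x y)).
- move=> C CP; have /set0Pn[x xC] := partition_neq0 Pp CP.
  by have [y yB Mxy] := totX x (sub _ _ CP xC); exists y => //; exists x.
- move=> y yB; have [x xD Mxy] := totY y yB.
  have xc : x \in cover (equivalence_partition R D) by rewrite (cover_partition Pp).
  exists (pblock (equivalence_partition R D) x); first by rewrite pblock_mem.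
  by exists x; rewrite ?mem_pblock.
- move=> C C' y CP C'P _ [x xC Mxy] [x' x'C' Mx'y].
  by apply/eqP; rewrite (same _ _ x x') //; exact: (MR _ _ _ Mxy Mx'y).
move=> C y y' CP _ _ [x xC Mxy] [x' x'C Mx'y']; apply: (Muniq _ _ _ _ _ Mxy Mx'y').
by rewrite -(same C C) ?eqxx.
Qed.

Section Image.
Variables (V : finType) (p : V -> V).
Hypothesis pI : injective p.

Definition graph_image (G : {set {set V}}) : {set {set V}} :=
  [set p @: e | e : {set V} in G].

Lemma adj_graph_image G x y : adj (graph_image G) (p x) (p y) = adj G x y.
Proof.
have e : [set p x; p y] = p @: [set x; y] by rewrite imsetU1 imset_set1.
by rewrite /adj e mem_imset //; apply: imset_inj.
Qed.

Lemma graph_image_graph G : is_graph G -> is_graph (graph_image G).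
Proof.
move/'forall_implyP => gG; apply/'forall_implyP => _ /imsetP[e eG ->].
by rewrite card_imset ?gG.
Qed.

Lemma graph_image_graph_of s : graph_image (graph_of s) = graph_of (push p s).
Proof.
have pT : p @: setT = setT.
  by apply/setP => x; rewrite inE -(f_invF pI x) imset_f.
apply: graph_ext; [exact/graph_image_graph/graph_of_graph|exact: graph_of_graph|].
move=> x y; have ps z : exists a, z = p a by exists (invF pI z); rewrite f_invF.
have [[a ->] [b ->]] := (ps x, ps y); rewrite adj_graph_image !adj_graph_of.
by rewrite /cover_adj !cover_le_push // (inj_eq pI).
Qed.

End Image.

Section Rooted.
Variable n : nat.
Hypothesis n2 : 2 < n.
Implicit Types (r : 'I_n) (G : {set {set 'I_n}}) (s : {set 'I_n * 'I_n}).

(** Defining it from the total preorder makes it a rooted 3-leaf power graph by [rooted_3LPP]. *)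
Definition complete_graph : {set {set 'I_n}} := graph_of (setX setT setT).

Lemma adj_complete x y : adj complete_graph x y = (x != y).
Proof.
rewrite adj_graph_of /cover_adj (_ : cover_le _ x y) ?andbT //.
by apply/cover_leP; split=> [|z _ _]; [|left]; rewrite !inE.
Qed.

Lemma rooted_3LPP r G : reflect
  (exists s, [/\ forest setT s, r \in root_block s & graph_of s = G])
  ((r, G) \in rooted_3LP n).
Proof.
rewrite inE /=; apply: (iffP and3P) => [[gG cG /asboolP]|[s [sF rs_ <-]]].
  case=> T [E [f [ET fI fL adjG]]].
  have [|s [sF rmin sG]] := leaf_root_preorder r gG cG _ ET fI fL adjG.
    by rewrite card_ord.
  by exists s; split=> //; rewrite inE; apply/forallP.
have rmin := root_block_in rs_; split.
- exact: graph_of_graph.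
- exact: graph_of_connected sF rmin.
by apply/asboolP; apply: (graph_of_leaf_power sF rmin); rewrite card_ord // ltnW.
Qed.

Lemma graph_of_spread s r : r \in root_block s -> forest setT s ->
  (graph_of s == complete_graph) = ~~ spread s.
Proof.
move=> rs_ sF; have rmin := root_block_in rs_.
apply/eqP/idP => [e|nsp]; last first.
  apply: graph_ext; [exact: graph_of_graph|exact: graph_of_graph|] => x y.
  by rewrite adj_complete adj_graph_of (not_spread_complete sF rmin).
apply/negP => /(spread_not_complete sF rmin)[x [y /andP[xy]]].
by rewrite -adj_graph_of e adj_complete xy.
Qed.

Lemma rooted_spread_in r s : (r, s) \in rooted_spread n =
  [&& forest setT s, r \in root_block s & spread s].
Proof. by rewrite inE. Qed.

Lemma complete_rooted r : (r, complete_graph) \in rooted_3LP n.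
Proof.
apply/rooted_3LPP; exists (setX setT setT); split=> //; first exact: total_forest.
by rewrite inE; apply/forallP => y; rewrite !inE.
Qed.

Lemma rooted_3LP_cases r G : (r, G) \in rooted_3LP n ->
  G = complete_graph \/ exists2 s, (r, s) \in rooted_spread n & graph_of s = G.
Proof.
move/rooted_3LPP => [s [sF rs_ <-]]; have := graph_of_spread rs_ sF.
have [sp|sp] := boolP (spread s); last by move/eqP; left.
by move=> _; right; exists s; rewrite // rooted_spread_in sF rs_.
Qed.

Lemma rooted_spread_3LP r s : (r, s) \in rooted_spread n ->
  (r, graph_of s) \in rooted_3LP n /\ graph_of s != complete_graph.
Proof.
rewrite rooted_spread_in => /and3P[sF rs_ sp].
by rewrite (graph_of_spread rs_ sF) sp; split=> //; apply/rooted_3LPP; exists s.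
Qed.

Lemma rooted_spread_inj r s s' : (r, s) \in rooted_spread n ->
  (r, s') \in rooted_spread n -> graph_of s = graph_of s' -> s = s'.
Proof.
rewrite !rooted_spread_in => /and3P[sF rs_ sp] /and3P[s'F rs' sp'].
by apply: (graph_of_inj (r := r)) => //; apply: root_block_in.
Qed.

Lemma card_rooted_3LP : #|rooted_3LP n| = #|rooted_spread n| + n.
Proof.
pose Phi (p : 'I_n * {set 'I_n * 'I_n}) := (p.1, graph_of p.2).
have PhiI : {in rooted_spread n &, injective Phi}.
  move=> [r s] [r' s'] rs_ rs' [e1 e2]; subst r'.
  by rewrite (rooted_spread_inj rs_ rs' e2).
pose Kn := [set (r, complete_graph) | r : 'I_n].
have cK : #|Kn| = n by rewrite card_imset ?card_ord // => r r' [].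
rewrite -(card_in_imset PhiI) -[X in _ + X]cK -cardsUI.
rewrite (_ : _ :&: _ = set0) ?cards0 ?addn0.
  apply: eq_card => -[r G]; rewrite in_setU; apply/idP/orP.
    case/rooted_3LP_cases => [->|[s rs_ <-]]; first by right; apply: imset_f.
    by left; apply/imsetP; exists (r, s).
  case=> /imsetP[]; first by case=> r' s rs_ [-> ->]; have [] := rooted_spread_3LP rs_.
  by move=> r' _ [-> ->]; apply: complete_rooted.
apply/setP => -[r G]; rewrite in_setI in_set0; apply/negP.
move=> /andP[/imsetP[[r' s] rs_ [_ ->]] /imsetP[r'' _ [_ e]]].
by have [_ /eqP[]] := rooted_spread_3LP rs_.
Qed.

End Rooted.

Lemma rooted_isoP n (x y : 'I_n * {set {set 'I_n}}) : reflect
  (exists2 p : {perm 'I_n}, p x.1 = y.1 & graph_image p x.2 = y.2) (rooted_iso x y).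
Proof.
apply: (iffP existsP) => [[p /andP[/eqP p1 /eqP p2]]|[p p1 p2]].
  by exists p.
by exists p; rewrite p1 eqxx /=; apply/eqP.
Qed.

Lemma rooted_iso_equivalence n : equivalence_rel (@rooted_iso n).
Proof.
have gi1 (G : {set {set 'I_n}}) : graph_image (1%g : {perm 'I_n}) G = G.
  rewrite /graph_image -[RHS]imset_id; apply: eq_imset => e.
  by rewrite -[RHS]imset_id; apply: eq_imset => x; rewrite perm1.
have giM (p q : {perm 'I_n}) (G : {set {set 'I_n}}) :
    graph_image q (graph_image p G) = graph_image (p * q)%g G.
  rewrite /graph_image -imset_comp; apply: eq_imset => e /=.
  by rewrite -imset_comp; apply: eq_imset => x /=; rewrite permM.
have tr : transitive (@rooted_iso n).
  move=> y x z /rooted_isoP[p p1 p2] /rooted_isoP[q q1 q2]; apply/rooted_isoP.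
  by exists (p * q)%g; rewrite ?permM ?p1 // -giM p2.
have sy : symmetric (@rooted_iso n).
  have half (x y : 'I_n * {set {set 'I_n}}) : rooted_iso x y -> rooted_iso y x.
    move=> /rooted_isoP[p p1 p2]; apply/rooted_isoP; exists (p^-1)%g.
      by rewrite -p1 permK.
    by rewrite -p2 giM mulgV gi1.
  by move=> x y; apply/idP/idP; apply: half.
move=> x y z; split; first by apply/rooted_isoP; exists 1%g; rewrite ?perm1.
move=> xy; apply/idP/idP => h; last exact: tr h.
by apply: tr h; rewrite sy.
Qed.

(** The invariant of a rooted graph: the type of the part below the root block, on [m < n] points as
    the root block is nonempty, or [None] for the complete graph. *)
Definition spread_type n :=
  option {m : 'I_n & {t : {set 'I_m * 'I_m} | (t \in reps m) && kind spread_kind setT t}}.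

Lemma card_spread_type n : #|{: spread_type n}| = (\sum_(m < n) ucount spread_kind m).+1.
Proof.
rewrite card_option card_Tagged; congr _.+1; apply: eq_bigr => m _.
by rewrite card_sig /ucount cardsE.
Qed.

Lemma spread_hang_kind (V : finType) (s : {set V * V}) : forest setT s ->
  spread s = kind spread_kind (~: root_block s) (restrict (~: root_block s) s).
Proof.
move=> sF; rewrite /kind (forest_restrict sF (subsetT _)) /spread_kind /spread; congr (~~ _).
apply/total_onP/total_onP => H x y xB yB; first by rewrite in_restrict xB yB H.
by have := H x y xB yB; rewrite in_restrict => /and3P[].
Qed.

Lemma card_unlabeled_3LP n : 2 < n ->
  #|unlabeled_3LP n| = (\sum_(m < n) ucount spread_kind m).+1.
Proof.
move=> n2; rewrite -card_spread_type card_sig -cardsE -[RHS]cardsT.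
rewrite (_ : [set C | _] = equivalence_partition (@rooted_iso n) (rooted_3LP n)); last first.
  by apply/setP => C; rewrite inE.
pose M (x : 'I_n * {set {set 'I_n}}) (y : spread_type n) : Prop :=
  if y is Some mt then exists s, [/\ (x.1, s) \in rooted_spread n, graph_of s = x.2 &
    has_type (val (tagged mt)) (~: root_block s) s]
  else x.2 = complete_graph n.
(* That [spread] survives relabeling is seen on the graphs: it means that the graph is not
   complete. *)
have transport (r r' : 'I_n) (p : {perm 'I_n}) s : (r, s) \in rooted_spread n -> p r = r' ->
    (r', push p s) \in rooted_spread n /\ has_type s setT (push p s).
  rewrite !rooted_spread_in => /and3P[sF rs_ sp] pr; have pI := @perm_inj _ p.
  have pT : p @: setT = setT by apply/setP => x; rewrite inE -[x](permKV p) imset_f.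
  have hs : has_type s setT (push p s) by exists p; rewrite restrictT.
  split=> //; have pF : forest setT (push p s) by rewrite -pT forest_push.
  have pr' : r' \in root_block (push p s) by rewrite root_block_push // -pr imset_f.
  rewrite pF pr' /=; apply: contraLR sp; rewrite -(graph_of_spread pr' pF).
  move=> /eqP e; rewrite -(graph_of_spread rs_ sF); apply/eqP.
  apply: graph_ext; [exact: graph_of_graph|exact: graph_of_graph|] => x y.
  rewrite -(adj_graph_image pI) graph_image_graph_of // e !adj_complete.
  by rewrite (inj_eq pI).
apply: (card_classes (M := M)).
- exact: rooted_iso_equivalence.
- move=> [r G] /(rooted_3LP_cases n2)[->|[s rs_ <-]]; first by exists None.
  move: (rs_); rewrite rooted_spread_in => /and3P[sF rr sp].
  have lt : #|~: root_block s| < n.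
    rewrite -[X in _ < X]card_ord -cardsT; apply: proper_card.
    rewrite properT; apply/negP => /eqP/setP/(_ r); rewrite !inE => /negP; apply.
    by move: rr; rewrite inE.
  have [t tR tt] := @type_exists _ _ (~: root_block s) s erefl.
  have tp : (t \in reps #|~: root_block s|) && kind spread_kind setT t.
    by rewrite tR -(has_type_kind _ tt) -spread_hang_kind.
  exists (Some (existT (fun m : 'I_n => {t : {set 'I_m * 'I_m} |
     (t \in reps m) && kind spread_kind setT t}) (Ordinal lt) (exist _ t tp))) => //.
  by exists s.
- case=> [[m [t tp]]|] _; last first.
    have r : 'I_n by exact: Ordinal (ltn_trans (isT : 0 < 2) n2).
    by exists (r, complete_graph n) => //; apply: complete_rooted.
  have /andP[tR tk] := tp; have tF := proj1 (andP tk).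
  have [s [sF sm] st] := hang_exists tF (ltn_ord m).
  move: sm; rewrite -root_block_neq0 => /set0Pn[r rr].
  have rs_ : (r, s) \in rooted_spread n.
    by rewrite rooted_spread_in sF rr spread_hang_kind // (has_type_kind _ st).
  exists (r, graph_of s); first by have [] := rooted_spread_3LP n2 rs_.
  by exists s.
- move=> [r G] [r' G'] [[m [t tp]]|] /=; last first.
    move=> -> ->; apply/rooted_isoP; exists (tperm r r'); rewrite ?tpermL //=.
    apply: graph_ext; first exact/graph_image_graph/graph_of_graph/perm_inj.
      exact: graph_of_graph.
    move=> x y; rewrite -[x](permKV (tperm r r')) -[y](permKV (tperm r r')).
    by rewrite adj_graph_image ?adj_complete ?(inj_eq perm_inj) //; apply: perm_inj.
  case=> s [rs_ <- st] [s' [rs' <- s't]].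
  move: rs_ rs'; rewrite !rooted_spread_in => /and3P[sF rr _] /and3P[s'F rr' _].
  have [g gI [gr gs]] := rooted_iso_exists sF s'F rr rr' st s't.
  apply/rooted_isoP; exists (perm gI); rewrite ?permE //=.
  rewrite graph_image_graph_of; last exact: perm_inj.
  by congr graph_of; rewrite -gs; apply: eq_push => x; rewrite permE.
move=> [r G] [r' G'] y y' /rooted_isoP[p /= pr pG].
have complete_iso : G = complete_graph n <-> G' = complete_graph n.
  have pI := @perm_inj _ p.
  split=> e; apply: graph_ext; try exact: graph_of_graph.
  - by rewrite -pG e; apply/graph_image_graph/graph_of_graph.
  - move=> x z; rewrite -pG e -[x](permKV p) -[z](permKV p) adj_graph_image //.
    by rewrite !adj_complete (inj_eq pI).
  - apply/'forall_implyP => a aG; have /'forall_implyP := graph_of_graph (setX [set: 'I_n] setT).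
    rewrite -/(complete_graph n) -e -pG => /(_ (p @: a)).
    by rewrite card_imset //; apply; apply: imset_f.
  by move=> x z; rewrite -(adj_graph_image pI) pG e !adj_complete (inj_eq pI).
case: y y' => [[m [t tp]]|] [[m' [t' tp']]|] //=.
- case=> s [rs_ sG st] [s' [rs' sG' s't]].
  have [ps hs] := transport _ _ _ _ rs_ pr.
  have e : push p s = s'.
    apply: (rooted_spread_inj ps rs'); rewrite -graph_image_graph_of; last exact: perm_inj.
    by rewrite sG pG.
  rewrite e in hs; have {}st := has_type_root hs st.
  have := has_type_card st; rewrite (has_type_card s't) !card_ord => /esym/val_inj mm'.
  have /andP[tR _] := tp; have /andP[t'R _] := tp'.
  subst m'; have tt' := type_uniq tR t'R st s't; subst t'.
  by rewrite (bool_irrelevance tp tp').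
- case=> s [rs_ sG st] /complete_iso GK.
  by have [_ /eqP[]] := rooted_spread_3LP n2 rs_; rewrite sG.
move=> /complete_iso GK [s' [rs' sG' _]].
by have [_ /eqP[]] := rooted_spread_3LP n2 rs'; rewrite sG'.
Qed.

(** * The system *)

(** Only the partition into singletons carries atoms on all its blocks, and it has [n] blocks. *)
Lemma card_lsetge_atom k n : #|lsetge k atom n| = (k <= n).
Proof.
rewrite card_lsetge; pose D := [set [set x] | x : 'I_n].
have DP : partition D setT.
  apply/and3P; split.
  - apply/eqP/setP => x; rewrite inE; apply/bigcupP; exists [set x]; rewrite ?inE //.
    exact: imset_f.
  - apply/trivIsetP => _ _ /imsetP[x _ ->] /imsetP[y _ ->] xy.
    by rewrite disjoints1 inE; apply: contraNneq xy => ->.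
  by apply/imsetP => -[x _ /setP/(_ x)]; rewrite !inE eqxx.
have cD : #|D| = n by rewrite card_imset ?card_ord //; exact: set1_inj.
have uD P : partition P setT -> (forall B, B \in P -> #|B| = 1) -> P = D.
  move=> PP P1; have /and3P[/eqP cP tP _] := PP.
  apply/setP => B; apply/idP/imsetP => [BP|[x _ ->]].
    by have /eqP/cards1P[x ->] := P1 _ BP; exists x.
  have /bigcupP[C CP xC] : x \in cover P by rewrite cP inE.
  by have /eqP/cards1P[y Cy] := P1 _ CP; move: xC CP; rewrite Cy inE => /eqP->.
transitivity (\sum_(P : {set {set 'I_n}} | partition P setT && (k <= #|P|)) (P == D)).
  apply: eq_bigr => P /andP[PP _]; have [->|PD] := eqVneq P D.
    by rewrite big1 // => _ /imsetP[x _ ->]; rewrite card_atom cards1.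
  have [B BP B1] : exists2 B, B \in P & #|B| != 1.
    apply/exists_inP; apply: contraNT PD => /exists_inPn P1; apply/eqP/uD => // B BP.
    by apply/eqP; rewrite -[_ == _]negbK P1.
  by rewrite (bigD1 B) //= card_atom (negbTE B1).
have [kn|nk] := leqP k n.
  by rewrite (bigD1 D) ?DP ?cD //= eqxx big1 // => P /andP[_ /negbTE->].
rewrite big1 // => P /andP[_ kP]; case: eqP => // PD.
by rewrite PD cD leqNgt nk in kP.
Qed.

Lemma card_usetge_atom k n : #|usetge k atom n| = (k <= n).
Proof.
have x1 (x : {i : 'I_n.+1 & atom i}) : tag x = 1 :> nat.
  case: x => i a /=; apply/eqP; rewrite -[_ == _]lt0b; exact: leq_ltn_trans (ltn_ord a).
have xy (x y : {i : 'I_n.+1 & atom i}) : x = y.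
  have := x1 x; rewrite -(x1 y) => /val_inj; case: x y => i a [j b] /= ij; subst j.
  have le1 k' (u v : 'I_k') : k' <= 1 -> u = v.
    by move=> k1; apply: ord_inj; have := ltn_ord u; have := ltn_ord v; lia.
  by rewrite (le1 _ a b (leq_b1 _)).
have sumE (m : {ffun {i : 'I_n.+1 & atom i} -> 'I_n.+1}) : \sum_x m x * tag x = \sum_x m x.
  by apply: eq_bigr => x _; rewrite x1 muln1.
have mE (m : {ffun {i : 'I_n.+1 & atom i} -> 'I_n.+1}) :
    (\sum_x m x == n) = (m == [ffun=> ord_max]).
  have [x _|no] := pickP (predT : pred {i : 'I_n.+1 & atom i}).
    rewrite (big_pred1 x) => [|y]; last by rewrite /= (xy y x) eqxx.
    apply/eqP/eqP => [mn|->]; last by rewrite ffunE.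
    by apply/ffunP => y; rewrite ffunE; apply: val_inj; rewrite (xy y x).
  (* An atom is available as soon as [n] is positive, so here [n = 0] and the empty multiset is the
     only candidate. *)
  rewrite big_pred0 //; have n0 : n = 0.
    apply/eqP; apply: contraT; rewrite -lt0n -ltnS => n1.
    by have := no (existT (fun i : 'I_n.+1 => atom i) (Ordinal n1) ord0).
  transitivity true; first by apply/eqP/esym.
  by apply/esym/eqP/ffunP => x; have := no x.
rewrite card_sig -cardsE.
have [kn|nk] := leqP k n.
  rewrite -[RHS]/1 -(cards1 ([ffun=> ord_max] : {ffun {i : 'I_n.+1 & atom i} -> 'I_n.+1})).
  apply: eq_card => m; rewrite !inE sumE -mE; case: eqP => // ->; exact: kn.
apply/eqP; rewrite cards_eq0; apply/eqP/setP => m; rewrite !inE sumE.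
by apply/negP => /andP[/eqP->]; rewrite leqNgt nk.
Qed.

Lemma card_lprod_atom (B : cclass) n : #|lprod atom B n| = n * #|B n.-1|.
Proof.
rewrite card_lprod (bigID (fun S : {set 'I_n} => #|S| == 1)) /= [X in _ + X]big1 ?addn0.
  rewrite (eq_bigr (fun=> #|B n.-1|)) => [|S /eqP S1].
    by rewrite sum_nat_const -cardsE card_draws card_ord bin1.
  by rewrite card_atom S1 mul1n cardsCs setCK card_ord S1 subn1.
by move=> S /negbTE S1; rewrite card_atom S1.
Qed.

Lemma card_uprod_atom (B : cclass) n : #|uprod atom B n| = (0 < n) * #|B n.-1|.
Proof.
rewrite card_uprod; case: n => [|n]; first by rewrite big_ord1 card_atom.
rewrite 2!big_ord_recl /= !card_atom /= mul0n add0n mul1n subn1 big1 ?addn0 ?mul1n //.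
Qed.

Section Solution.
Variables (st : setting) (SX0 : cclass).

(** S_X is the only recursive unknown. All other classes are defined by their equations from [SX0],
    and the equation of S_X alone remains to be checked. *)
Definition solution : classes :=
  let L0 := csum atom (csetge st 2 atom) in
  let Ld0 := csum atom (cprod st atom (csetge st 1 atom)) in
  let Kd0 := cprod st atom (csetge st 2 atom) in
  let SC0 := csetge st 2 (csum L0 SX0) in
  Classes (csum (cprod st Ld0 (csum SC0 SX0)) Kd0) SC0 SX0 L0 Ld0 Kd0.

Lemma solution_system :
  (forall n, #|SX0 n| = #|cprod st (L solution) (csetge st 1 (csum (L solution) SX0)) n|) ->
  system st solution.
Proof. by move=> SXE; do !split. Qed.

Variable C : cclass.
Hypothesis stL : local_setting st.
Hypothesis SXE :
  forall n, #|SX0 n| = #|cprod st (L solution) (csetge st 1 (csum (L solution) SX0)) n|.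

Lemma specified_solution : no_size0 solution ->
  (forall n, 2 < n -> #|C n| = #|LP solution n|) -> specified_from 3 st C.
Proof.
move=> S0 CE; exists solution; split=> [|Y SY Y0|//].
  by split=> //; apply: solution_system.
exact: system_unique stL (solution_system SXE) S0 SY Y0.
Qed.

End Solution.

Lemma kind_size0 g : (forall m, g m true true = false) ->
  forall s : {set 'I_0 * 'I_0}, kind g setT s = false.
Proof.
move=> g0 s; have e : [set: 'I_0] = set0 by apply/setP => -[].
by rewrite /kind e total_set0 eqxx g0 andbF.
Qed.

Definition lthick : cclass :=
  fun n => {s : {set 'I_n * 'I_n} | kind thick_tree_kind setT s}.

Definition uthick : cclass :=
  fun n => {s : {set 'I_n * 'I_n} | (s \in reps n) && kind thick_tree_kind setT s}.

Lemma card_lthick n : #|lthick n| = lcount thick_tree_kind n.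
Proof. by rewrite card_sig /lcount cardsE. Qed.

Lemma card_uthick n : #|uthick n| = ucount thick_tree_kind n.
Proof. by rewrite card_sig /ucount cardsE. Qed.

Lemma positive_split n : (n == 1) + (1 < n) = (0 < n).
Proof. by case: n => [|[]]. Qed.

Lemma labeled_specified : specified_from 3 labeled labeled_3LP.
Proof.
pose X := solution labeled lthick.
have LE n : #|L X n| = (0 < n).
  by rewrite card_csum card_atom card_lsetge_atom positive_split.
(* A labeled block of size [n] has [n] choices for its root; in the unlabeled setting there is just
   one for [n > 0]. *)
have LdE n : #|Ld X n| = n.
  rewrite card_csum card_atom card_lprod_atom card_lsetge_atom.
  by case: n => [|[]] //= n; rewrite muln1.
have KdE n : #|Kd X n| = n * (2 < n).
  by rewrite card_lprod_atom card_lsetge_atom; case: n.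
have treeE n : #|csum (L X) lthick n| = lcount tree_kind n.
  by rewrite card_csum LE card_lthick lcount_tree addnC.
have SCE n : #|SC X n| = lcount forest2_kind n by rewrite lcount_forest2.
have spreadE n : #|csum (SC X) lthick n| = lcount spread_kind n.
  by rewrite card_csum SCE card_lthick lcount_spread.
have zero g : (forall m, g m true true = false) -> lcount g 0 = 0.
  by move=> g0; apply/eqP; rewrite cards_eq0; apply/eqP/setP => s; rewrite !inE kind_size0.
apply: (@specified_solution _ lthick); first exact: labeled_local.
- move=> n; rewrite card_lthick lcount_thick_tree card_lprod; apply: eq_bigr => A _.
  by rewrite LE lcount_forest1.
- split; rewrite ?LE ?LdE ?KdE //.
    by rewrite SCE zero.
  by rewrite card_lthick zero // => m; rewrite /thick_tree_kind andbF.
move=> n n2; rewrite card_sig card_csum KdE n2 muln1 -cardsE.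
rewrite (_ : [set rG | _] = rooted_3LP n); last by apply/setP => rG; rewrite inE.
rewrite card_rooted_3LP // card_rooted_spread card_lprod; congr (_ + _).
by apply: eq_bigr => A _; rewrite LdE spreadE.
Qed.

Lemma ucount_forest (A : cclass) k n : (forall i, #|A i| = ucount tree_kind i) ->
  #|usetge k A n| =
  #|[set s in reps n | forest setT s && (k <= #|components s setT|)]|.
Proof.
move=> AE; rewrite -card_usetge_tree_type; apply: eq_usetge => i _.
by rewrite AE card_tree_type.
Qed.

Lemma ucount_forest1 (A : cclass) n : (forall i, #|A i| = ucount tree_kind i) ->
  #|usetge 1 A n| = ucount forest1_kind n.
Proof.
move/ucount_forest->; apply: eq_card => s; rewrite !in_set /kind.
by case: (boolP (forest _ s)) => // sF; rewrite card_components_gt0.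
Qed.

Lemma ucount_forest2 (A : cclass) n : (forall i, #|A i| = ucount tree_kind i) ->
  #|usetge 2 A n| = ucount forest2_kind n.
Proof.
move/ucount_forest->; apply: eq_card => s; rewrite !in_set /kind.
by case: (boolP (forest _ s)) => // sF; rewrite card_components_gt1.
Qed.

Lemma unlabeled_specified : specified_from 3 unlabeled unlabeled_3LP.
Proof.
pose X := solution unlabeled uthick.
have LE n : #|L X n| = (0 < n).
  by rewrite card_csum card_atom card_usetge_atom positive_split.
have LdE n : #|Ld X n| = (0 < n).
  by rewrite card_csum card_atom card_uprod_atom card_usetge_atom; case: n => [|[]].
have KdE n : #|Kd X n| = (2 < n).
  by rewrite card_uprod_atom card_usetge_atom; case: n => [|n]; rewrite ?mul1n.
have treeE n : #|csum (L X) uthick n| = ucount tree_kind n.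
  by rewrite card_csum LE card_uthick ucount_tree addnC.
have SCE n : #|SC X n| = ucount forest2_kind n by rewrite ucount_forest2.
have spreadE n : #|csum (SC X) uthick n| = ucount spread_kind n.
  by rewrite card_csum SCE card_uthick ucount_spread.
have zero g : (forall m, g m true true = false) -> ucount g 0 = 0.
  move=> g0; apply/eqP; rewrite cards_eq0; apply/eqP/setP => s.
  by rewrite !in_set kind_size0 ?andbF.
apply: (@specified_solution _ uthick); first exact: unlabeled_local.
- move=> n; rewrite card_uthick ucount_thick_tree card_uprod; apply: eq_bigr => k _.
  by rewrite LE ucount_forest1.
- split; rewrite ?LE ?LdE ?KdE //.
    by rewrite SCE zero.
  by rewrite card_uthick zero // => m; rewrite /thick_tree_kind andbF.
move=> n n2; rewrite card_unlabeled_3LP // card_csum KdE n2 addn1; congr _.+1.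
(* The product sums over the size of the root block, the graphs over the size of the part below it;
   the term of size 0 vanishes and the remaining sum is reversed. *)
rewrite card_uprod big_ord_recl /= LdE mul0n add0n (reindex_inj rev_ord_inj) /=.
by apply: eq_bigr => k _; rewrite LdE mul1n spreadE.
Qed.

Theorem theorem1 :
  specified_from 3 labeled labeled_3LP /\
  specified_from 3 unlabeled unlabeled_3LP.
Proof. by split; [exact: labeled_specified | exact: unlabeled_specified]. Qed.
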